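(* Let $\Omega$ be bounded and strictly convex. Let $u$ be the convex envelope of $f$ in $\Omega$ (equivalently, the viscosity solution of $\min\{f-u,\lambda_1[D^2u]\}=0$ in $\Omega$, $u=f$ on $\partial\Omega$), and let $u_\varepsilon\in\mathbb V_h$ be the discrete solution of $$T_\varepsilon[u_\varepsilon;f](x_i)=0\quad\forall x_i\in\mathcal N_h^0,\qquad u_\varepsilon(x_i)=f(x_i)\quad\forall x_i\in\mathcal N_h^b .$$ If $u\in C^{k,\alpha}(\overline\Omega)$ for $k\in\{0,1\}$ and $0<\alpha\le1$, and $\theta\le1$, then $$\|u-u_\varepsilon\|_{L^\infty(\Omega_h)}\le C(\Omega,d,\sigma)\Big(|u|_{C^{k,\alpha}(\overline\Omega)}+|f|_{C^{k,\alpha}(\overline\Omega)}\Big)\,h^{\frac{(k+\alpha)^2}{2+k+\alpha}},$$ provided $$\delta=R_\alpha(u)\,h^{\frac{k+\alpha}{2+k+\alpha}},\qquad \theta=R_\alpha(u)^{-1}h^{\frac{2}{2+k+\alpha}},$$ where $R_\alpha(u):=|u|_{C^{k,\alpha}(\overline\Omega)}^{\frac1{2+k+\alpha}}\Big(|u|_{C^{k,\alpha}(\overline\Omega)}+|f|_{C^{k,\alpha}(\overline\Omega)}\Big)^{-\frac1{2+k+\alpha}}$.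
   Context: $\Omega\subset\mathbb R^d$ is open and $f\in C(\overline\Omega)$. The convex envelope is $u(x)=\sup\{l(x): l\le f\text{ in }\overline\Omega,\ l\text{ affine}\}$; $\lambda_1[D^2u]$ is the smallest eigenvalue of the Hessian. $|\cdot|_{C^{k,\alpha}}$ denotes the Hölder seminorm with exponent $\alpha$ of the derivatives of order $k$. The definition of $\delta,\theta$ presupposes $f\in C^{k,\alpha}(\overline\Omega)$ and $|u|_{C^{k,\alpha}(\overline\Omega)}>0$. $\mathcal T_h$ is a conforming mesh of closed simplices $T$ with mesh size $h$, shape-regular and quasi-uniform with constant $\sigma$: $h_T/\rho_T\le\sigma$ and $h\le\sigma h_T\le\sigma h$ for all $T\in\mathcal T_h$, where $h_T$ is the diameter of $T$ and $\rho_T$ the diameter of the largest ball inscribed in $T$. $\Omega_h$ is the interior of the union of the elements; $\mathcal N_h$ is the set of nodes (vertices), $\mathcal N_h^b:=\{x_i\in\mathcal N_h: x_i\in\partial\Omega\}$ and $\mathcal N_h^0:=\mathcal N_h\setminus\mathcal N_h^b$. The nodes lying on $\partial\Omega_h$ are required to lie on $\partial\Omega$, and $\Omega_h\subset\Omega$ is convex. $\mathbb V_h$ is the space of continuous piecewise linear functions over $\mathcal T_h$. $\mathbb S$ is the unit sphere of $\mathbb R^d$, and $\mathbb S_\theta\subset\mathbb S$ is a finite set such that for every $v\in\mathbb S$ there is $v^\theta\in\mathbb S_\theta$ with $|v-v^\theta|\le\theta$. The coarse scale satisfies $\delta\ge h$, and for $x_i\in\mathcal N_h^0$, $\delta_i:=\min\{\delta,\mathrm{dist}(x_i,\partial\Omega_h)\}$.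 For $w\in C(\overline{\Omega}_h)$, $x_i\in\mathcal N_h^0$, $v\in\mathbb S$, $$\nabla^2_\delta w(x_i;v):=\frac{w(x_i+\delta_i v)-2w(x_i)+w(x_i-\delta_i v)}{\delta_i^2}.$$ For $w_h\in\mathbb V_h$ and $x_i\in\mathcal N_h^0$, $$T_\varepsilon[w_h;f](x_i):=\min\Big\{f(x_i)-w_h(x_i),\ \min_{v\in\mathbb S_\theta}\nabla^2_\delta w_h(x_i;v)\Big\},\qquad \varepsilon=(h,\delta,\theta).$$ The discrete problem has a unique solution. The constant $C(\Omega,d,\sigma)$ depends only on $\Omega,d,\sigma$. *)

(* Defs.v *)
From HB Require Import structures.
From mathcomp Require Import all_boot all_order all_algebra.
From mathcomp Require Import all_classical all_reals all_analysis.
Set Implicit Arguments.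
Unset Strict Implicit.
Unset Printing Implicit Defensive.
Import Order.TTheory GRing.Theory Num.Theory.
Import numFieldNormedType.Exports.
Local Open Scope classical_set_scope.
Local Open Scope ring_scope.

Section Geometry.
Variables (R : realType) (d : nat).
Implicit Types (x y a : 'rV[R]_d) (A : set 'rV[R]_d).

Definition dotp x y : R := \sum_(i < d) x ord0 i * y ord0 i.

(* The library norm `|x| on 'rV[R]_d is the sup norm: it gives the right
   topology and the right bounded sets, but every length below is Euclidean. *)
Definition enorm x : R := Num.sqrt (dotp x x).

Definition affine_fun (l : 'rV[R]_d -> R) : Prop :=
  exists a (b : R), forall x, l x = dotp a x + b.

Definition boundary A : set 'rV[R]_d := closure A `\` interior A.

Definition diam A : R := sup [set enorm (x - y) | x in A & y in A].

Definition dist x A : R := inf [set enorm (x - y) | y in A].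

Definition inradius_diam A : R :=
  sup [set 2 * r | r in [set r | 0 <= r /\
         exists c, forall x, enorm (x - c) <= r -> A x]].

Definition strictly_convex A : Prop :=
  forall x y (t : R), closure A x -> closure A y -> x != y -> 0 < t < 1 ->
    A (t *: x + (1 - t) *: y).

Definition sup_norm A (g : 'rV[R]_d -> R) : \bar R :=
  ereal_sup [set `|g x|%:E | x in A].

End Geometry.

Section Holder.
Variables (R : realType) (d : nat).
Implicit Types (f g : 'rV[R]_d -> R) (Om : set 'rV[R]_d).

(* Functions on the closure of Om are represented by total functions on R^d;
   for Om open, 'D_v f x with x in Om only depends on f inside Om. *)
Definition pderiv (s : seq 'I_d) f : 'rV[R]_d -> R :=
  foldr (fun i g x => 'D_(delta_mx ord0 i) g x) f s.

(* The derivatives of order k are only evaluated in the open set Om: they extend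
   continuously to the closure, on which the supremum of the quotients is the
   same. *)
Definition holder_quotients (k : nat) (alpha : R) Om f : set R :=
  [set q | exists (s : k.-tuple 'I_d) (x y : 'rV[R]_d),
     [/\ Om x, Om y, x != y &
         q = `|pderiv s f x - pderiv s f y| / enorm (x - y) `^ alpha]].

Definition holder_seminorm (k : nat) (alpha : R) Om f : R :=
  sup (holder_quotients k alpha Om f).

Definition Ck_closure (k : nat) Om f : Prop :=
  [/\ {within closure Om, continuous f},
      forall (s : seq 'I_d) (i : 'I_d) x, (size s < k)%N -> Om x ->
        derivable (pderiv s f) x (delta_mx ord0 i)
    & forall s : seq 'I_d, (size s <= k)%N ->
        exists2 g, {within closure Om, continuous g} &
                   forall x, Om x -> g x = pderiv s f x].

Definition holder_class (k : nat) (alpha : R) Om f : Prop :=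
  Ck_closure k Om f /\ has_ubound (holder_quotients k alpha Om f).

(* Meaningful at the points of closure Om. *)
Definition convex_envelope Om f (x : 'rV[R]_d) : R :=
  sup [set l x | l in [set l | affine_fun l /\
                               forall y, closure Om y -> l y <= f y]].

End Holder.

(* A simplex is given by the matrix whose d + 1 rows are its vertices, and a
   mesh by the finite sequence of its simplices. *)
Section Mesh.
Variables (R : realType) (d : nat).
Implicit Types (P Q : 'M[R]_(d.+1, d)) (x v : 'rV[R]_d).
Implicit Types (Th : seq 'M[R]_(d.+1, d)) (Om : set 'rV[R]_d).
Implicit Types (f w : 'rV[R]_d -> R) (S : seq 'rV[R]_d).

Definition vertex P x : Prop := exists i, x = row i P.

Definition face P (I : set 'I_d.+1) : set 'rV[R]_d :=
  [set x | exists c : 'rV[R]_d.+1,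
     [/\ forall i, 0 <= c ord0 i, forall i, ~ I i -> c ord0 i = 0,
         \sum_i c ord0 i = 1 & x = c *m P]].

Definition simplex P : set 'rV[R]_d := face P setT.

Definition nondegenerate P : bool :=
  row_free (\matrix_(i < d) (row (lift ord0 i) P - row ord0 P)).

Definition conforming_mesh Th : Prop :=
  {in Th, forall P, nondegenerate P} /\
  {in Th &, forall P Q,
     simplex P `&` simplex Q = face P [set i | vertex Q (row i P)]}.

Definition mesh_size Th : R := \big[Num.max/0]_(P <- Th) diam (simplex P).

Definition shape_regular (sigma : R) Th : Prop :=
  {in Th, forall P,
     diam (simplex P) / inradius_diam (simplex P) <= sigma}.

Definition quasi_uniform (sigma : R) Th : Prop :=
  {in Th, forall P, mesh_size Th <= sigma * diam (simplex P) /\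
                    sigma * diam (simplex P) <= sigma * mesh_size Th}.

Definition mesh_union Th : set 'rV[R]_d :=
  [set x | exists2 P, P \in Th & simplex P x].

Definition mesh_domain Th : set 'rV[R]_d := interior (mesh_union Th).

Definition node Th : set 'rV[R]_d :=
  [set x | exists2 P, P \in Th & vertex P x].

Definition bnode Om Th : set 'rV[R]_d := node Th `&` boundary Om.

Definition inode Om Th : set 'rV[R]_d := node Th `\` bnode Om Th.

Definition admissible_mesh Om (sigma : R) Th : Prop :=
  [/\ conforming_mesh Th,
      shape_regular sigma Th /\ quasi_uniform sigma Th,
      node Th `&` boundary (mesh_domain Th) `<=` boundary Om,
      mesh_domain Th `<=` Om
    & convex_set (M := 'rV[R]_d) (mesh_domain Th)].

Definition fe_space Th w : Prop :=
  {within mesh_union Th, continuous w} /\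
  {in Th, forall P, exists2 l, affine_fun l &
                               forall x, simplex P x -> w x = l x}.

Definition direction_net (theta : R) S : Prop :=
  {in S, forall v, enorm v = 1} /\
  forall v, enorm v = 1 -> exists2 v', v' \in S & enorm (v - v') <= theta.

Definition delta_node Th (delta : R) x : R :=
  Num.min delta (dist x (boundary (mesh_domain Th))).

Definition second_diff Th (delta : R) w x v : R :=
  let di := delta_node Th delta x in
  (w (x + di *: v) - 2 * w x + w (x - di *: v)) / di ^+ 2.

(* \big[Num.min/a]_(v <- S) b v is min {a, min_(v in S) b v}. *)
Definition T_eps Th (delta : R) S f w x : R :=
  \big[Num.min/(f x - w x)]_(v <- S) second_diff Th delta w x v.

Definition discrete_solution Om Th (delta : R) S f w : Prop :=
  [/\ fe_space Th w,
      forall x, inode Om Th x -> T_eps Th delta S f w x = 0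
    & forall x, bnode Om Th x -> w x = f x].

Definition R_alpha (k : nat) (alpha : R) Om f : R :=
  let su := holder_seminorm k alpha Om (convex_envelope Om f) in
  let sf := holder_seminorm k alpha Om f in
  su `^ (2 + k%:R + alpha)^-1 * (su + sf) `^ (- (2 + k%:R + alpha)^-1).

End Mesh.

(* Main.v *)
Require Import Defs.
From HB Require Import structures.
From mathcomp Require Import all_boot all_order all_algebra.
From mathcomp Require Import all_classical all_reals all_analysis.
From mathcomp Require Import ring lra.
Set Implicit Arguments.
Unset Strict Implicit.
Unset Printing Implicit Defensive.
Import Order.TTheory GRing.Theory Num.Theory.
Import numFieldNormedType.Exports.
Local Open Scope classical_set_scope.
Local Open Scope ring_scope.

(** Write beta = k + alpha, su and sf for the two seminorms, G for the domain of the
    mesh, and E for h ^ (beta ^ 2 / (2 + beta)). The proof compares the discrete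
    solution with the convex envelope u from both sides.

    The envelope is affine along simplices with contact points as vertices: the
    graph of f over the closure of Om is compact, and a separation argument in
    dimension d + 1 shows that u x is a mean of values of f at d + 3 points with
    mean x ([envelope_attained]). By Jensen's inequality f = u at those of positive
    weight. If x is a boundary point, hence extreme by strict convexity, these are
    all equal to x, so that u = f on the boundary ([envelope_boundary]).

    The lower bound is exact. Since u is convex, its interpolant lies above u, and
    hence is a discrete subsolution; the discrete maximum principle gives u <= ueps
    ([envelope_le_nodes]).

    For the upper bound u is raised to a strict supersolution U by a constant K1, a
    concave barrier in the boundary layer and a concave quadratic function
    ([strict_supersolution]). At a node x at a distance larger than M * delta from
    the boundary of G, where M = d + 2, look at the contact point of largest weight
    in the representation of u x. If it is closer than M * delta, then f - u is at
    most of the order (su + sf) * delta ^ beta at x ([near_contact]), and U >= f.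
    Otherwise u does not bend at x over the distance delta in its direction
    ([flat_segment]). Replacing this direction by one of the net costs
    su * (delta * theta) ^ beta = su * h ^ beta ([flat_direction]), interpolation
    costs as much ([jensen_gap]), and the quadratic term, whose coefficient is of
    the order su * h ^ beta / delta ^ 2, absorbs both.

    In the layer the steps of the scheme shrink with the distance s to the boundary
    and the quadratic term is too weak. If k = 0, boundary nodes are contact points
    close to x and again U >= f. If k = 1, this fails because the gradient of f - u
    need not vanish on the boundary. The barrier, a multiple of
    delta ^ (beta - 1 / 2) * s ^ (1 / 2), then provides second differences of this
    size in a direction close to the normal ([barrier_layer]), which dominate
    su * (s ^ beta + h ^ beta); shape regularity enters through h <= sigma ^ 2 * s
    ([inode_dist]). The barrier and the quadratic term are concave, so that
    interpolating them costs nothing.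

    The choice of delta and theta makes delta ^ beta, h ^ beta and
    su * h ^ beta / ((su + sf) * delta ^ 2) at most E ([balance_constant]), and the
    three terms of U add up to a multiple of (su + sf) * E. *)

(** * The Euclidean norm *)

Section Euclid.
Variables (R : realType) (d : nat).
Implicit Types (x y z a v : 'rV[R]_d) (A : set 'rV[R]_d).

Lemma dotpC x y : dotp x y = dotp y x.
Proof. by apply: eq_bigr => i _; rewrite mulrC. Qed.

Lemma dotpDr x y z : dotp x (y + z) = dotp x y + dotp x z.
Proof. by rewrite -big_split; apply: eq_bigr => i _; rewrite mxE mulrDr. Qed.

Lemma dotpZr t x y : dotp x (t *: y) = t * dotp x y.
Proof. by rewrite mulr_sumr; apply: eq_bigr => i _; rewrite mxE; ring. Qed.

Lemma dotpNr x y : dotp x (- y) = - dotp x y.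
Proof. by rewrite -scaleN1r dotpZr mulN1r. Qed.

Lemma dotpBr x y z : dotp x (y - z) = dotp x y - dotp x z.
Proof. by rewrite dotpDr dotpNr. Qed.

Lemma dotpDl x y z : dotp (y + z) x = dotp y x + dotp z x.
Proof. by rewrite !(dotpC _ x) dotpDr. Qed.

Lemma dotpZl t x y : dotp (t *: y) x = t * dotp y x.
Proof. by rewrite !(dotpC _ x) dotpZr. Qed.

Lemma dotpNl x y : dotp (- y) x = - dotp y x.
Proof. by rewrite !(dotpC _ x) dotpNr. Qed.

Lemma dotpBl x y z : dotp (y - z) x = dotp y x - dotp z x.
Proof. by rewrite dotpDl dotpNl. Qed.

Definition dotpE := (dotpDr, dotpDl, dotpNr, dotpNl, dotpZr, dotpZl).

Lemma dotp_sumr (I : finType) (F : I -> 'rV[R]_d) x :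
  dotp x (\sum_i F i) = \sum_i dotp x (F i).
Proof.
apply: (big_morph (dotp x)) => [y z|]; first exact: dotpDr.
by rewrite -(scale0r x) dotpZr mul0r.
Qed.

Lemma dotp_ge0 x : 0 <= dotp x x.
Proof. by apply: sumr_ge0 => i _; rewrite -expr2 sqr_ge0. Qed.

Lemma enorm_ge0 x : 0 <= enorm x.
Proof. exact: sqrtr_ge0. Qed.

Lemma sqr_enorm x : enorm x ^+ 2 = dotp x x.
Proof. by rewrite sqr_sqrtr ?dotp_ge0. Qed.

Lemma enormZ t x : enorm (t *: x) = `|t| * enorm x.
Proof.
by rewrite /enorm dotpZr dotpZl mulrA -expr2 sqrtrM ?sqr_ge0// sqrtr_sqr.
Qed.

Lemma enorm0 : enorm (0 : 'rV[R]_d) = 0.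
Proof. by rewrite -(scale0r 0) enormZ normr0 mul0r. Qed.

Lemma enormN x : enorm (- x) = enorm x.
Proof. by rewrite -scaleN1r enormZ normrN normr1 mul1r. Qed.

Lemma enormC x y : enorm (x - y) = enorm (y - x).
Proof. by rewrite -enormN opprB. Qed.

Lemma enorm_coord x i : `|x ord0 i| <= enorm x.
Proof.
rewrite -sqrtr_sqr ler_sqrt ?dotp_ge0// /dotp (bigD1 i)//= -expr2 lerDl.
by apply: sumr_ge0 => j _; rewrite -expr2 sqr_ge0.
Qed.

Lemma enorm_eq0 x : (enorm x == 0) = (x == 0).
Proof.
apply/eqP/eqP => [x0|->]; last exact: enorm0.
apply/rowP => i; rewrite mxE; apply/eqP; rewrite -normr_le0 -x0.
exact: enorm_coord.
Qed.

Lemma enorm_gt0 x : (0 < enorm x) = (x != 0).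
Proof. by rewrite lt_neqAle enorm_ge0 andbT eq_sym enorm_eq0. Qed.

(** Expand the nonnegative squared norm of [(y . y) x - (x . y) y]. *)
Lemma dotp_le_enorm x y : `|dotp x y| <= enorm x * enorm y.
Proof.
have nn : 0 <= enorm x * enorm y by rewrite mulr_ge0 ?enorm_ge0.
rewrite -(@ler_pXn2r _ 2)// real_normK ?num_real// exprMn !sqr_enorm.
have [->|y0] := eqVneq y 0.
  by rewrite -(scale0r 0) !dotpZr !mul0r expr0n mulr0.
have yy : 0 < dotp y y by rewrite -sqr_enorm exprn_gt0// enorm_gt0.
have := dotp_ge0 (dotp y y *: x - dotp x y *: y).
rewrite !dotpE (dotpC y x) => H.
rewrite -(ler_pM2r yy); nra.
Qed.

Lemma dotp_le x y : dotp x y <= enorm x * enorm y.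
Proof. exact: le_trans (ler_norm _) (dotp_le_enorm x y). Qed.

Lemma dotp_sqrB x y : dotp (x - y) (x - y) = dotp x x - 2 * dotp x y + dotp y y.
Proof. by rewrite !dotpE (dotpC y x); ring. Qed.

Lemma dotp_sqrD x y : dotp (x + y) (x + y) = dotp x x + 2 * dotp x y + dotp y y.
Proof. by rewrite !dotpE (dotpC y x); ring. Qed.

Lemma enormD x y : enorm (x + y) <= enorm x + enorm y.
Proof.
rewrite -(@ler_pXn2r _ 2)// ?nnegrE ?addr_ge0 ?enorm_ge0// sqr_enorm !dotpE (dotpC y x).
by rewrite sqrrD !sqr_enorm; have := dotp_le x y; lra.
Qed.

Lemma enorm_sum (I : finType) (F : I -> 'rV[R]_d) :
  enorm (\sum_i F i) <= \sum_i enorm (F i).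
Proof.
elim/big_ind2: _ => [|x1 x2 y1 y2 h1 h2|//]; first by rewrite enorm0.
by apply: le_trans (enormD _ _) _; exact: lerD.
Qed.

Lemma norm_le_enorm x : `|x| <= enorm x.
Proof.
have -> : `|x| = _ := mx_normrE x; apply/bigmax_leP.
split => [|[i j] _]; first exact: enorm_ge0.
by rewrite /= (ord1 i) enorm_coord.
Qed.

Lemma enorm_le_norm x : enorm x <= d%:R * `|x|.
Proof.
rewrite [x in enorm x](row_sum_delta x).
apply: (le_trans (enorm_sum _)).
rewrite -[d in d%:R]card_ord mulr_natl -sumr_const; apply: ler_sum => i _.
rewrite enormZ.
have -> : enorm (delta_mx ord0 i : 'rV[R]_d) = 1.
  rewrite /enorm /dotp (bigD1 i)//= big1 => [|j ji].
    by rewrite !mxE !eqxx mulr1 addr0 sqrtr1.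
  by rewrite !mxE eqxx (negPf ji) mulr0.
rewrite mulr1; have -> : `|x| = _ := mx_normrE x.
exact: (le_bigmax _ (fun ij => `|x ij.1 ij.2|) (ord0, i)).
Qed.

End Euclid.

(** * Topology in terms of the Euclidean norm *)

Section EuclidTopology.
Variables (R : realType) (d : nat).
Implicit Types (x y z a v : 'rV[R]_d) (A : set 'rV[R]_d).

Lemma nbhs_enormP x A :
  nbhs x A <-> exists2 r, 0 < r & forall y, enorm (y - x) < r -> A y.
Proof.
split=> [/nbhs_ballP[r /= r0 rA]|[r r0 rA]].
  exists r => // y yx; apply: rA; rewrite -ball_normE/=.
  by rewrite -opprB normrN; exact: le_lt_trans (norm_le_enorm _) yx.
have d0 : 0 < d%:R + 1 :> R by rewrite ltr_wpDl.
apply/nbhs_ballP; exists (r / (d%:R + 1)) => /=; first exact: divr_gt0.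
move=> y; rewrite -ball_normE/= -opprB normrN ltr_pdivlMr// => yx; apply: rA.
apply: le_lt_trans yx; apply: le_trans (enorm_le_norm _) _.
by rewrite mulrC ler_wpM2l// lerDl.
Qed.

Lemma open_enorm A x : open A -> A x ->
  exists2 r, 0 < r & forall y, enorm (y - x) < r -> A y.
Proof. by move=> oA Ax; apply/nbhs_enormP; exact: open_nbhs_nbhs. Qed.

Lemma closure_enormP A x :
  closure A x <-> forall r, 0 < r -> exists2 y, A y & enorm (y - x) < r.
Proof.
split=> [cA r r0|H B /nbhs_enormP[r r0 rB]].
  have /cA[y [Ay yr]] : nbhs x [set y | enorm (y - x) < r].
    by apply/nbhs_enormP; exists r.
  by exists y.
by have [y Ay yr] := H r r0; exists y; split => //; exact: rB.
Qed.

Lemma enorm_lipschitz_continuous (g : 'rV[R]_d -> R) (L : R) :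
  (forall x y, `|g y - g x| <= L * enorm (y - x)) -> continuous g.
Proof.
move=> gL x; apply/(@cvgrPdist_lt R _ _ (nbhs x)) => e e0; apply/nbhs_enormP.
have L0 : 0 < `|L| + 1 by rewrite ltr_wpDl.
exists (e / (`|L| + 1)); first exact: divr_gt0.
move=> y; rewrite ltr_pdivlMr// => ye; rewrite distrC.
apply: le_lt_trans ye; apply: le_trans (gL x y) _; rewrite mulrC.
rewrite ler_wpM2l ?enorm_ge0//; have := ler_norm L; lra.
Qed.

Lemma enormB_continuous a : continuous (fun x => enorm (x - a)).
Proof.
apply: (@enorm_lipschitz_continuous _ 1) => x y; rewrite mul1r ler_norml.
have := enormD (y - x) (x - a); rewrite addrA subrK.
have := enormD (x - y) (y - a); rewrite addrA subrK (enormC x y); lra.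
Qed.

Lemma affine_continuous (l : 'rV[R]_d -> R) : affine_fun l -> continuous l.
Proof.
move=> [a [b lE]].
apply: (@enorm_lipschitz_continuous _ (enorm a)) => x y.
by rewrite !lE opprD addrACA subrr addr0 -dotpBr dotp_le_enorm.
Qed.

Lemma affineD (l : 'rV[R]_d -> R) : affine_fun l ->
  exists a, forall x y, l y = l x + dotp a (y - x).
Proof. by move=> [a [b lE]]; exists a => x y; rewrite !lE dotpBr; ring. Qed.

Lemma bounded_closure_enorm A : bounded_set A ->
  exists2 rho, 0 < rho & forall x, closure A x -> enorm x <= rho.
Proof.
case/ex_strict_bound_gt0 => M M0 MA.
exists (d%:R * M + 1) => [|x /closure_enormP xA].
  by rewrite ltr_wpDl// mulr_ge0// ltW.
have [y Ay yx] := xA 1 ltr01.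
have := enormD y (x - y); rewrite addrC subrK enormC => /le_trans; apply.
rewrite lerD ?(ltW yx)//; apply: le_trans (enorm_le_norm _) _.
by rewrite ler_wpM2l// ltW// MA.
Qed.

Lemma compact_closure_bounded A : bounded_set A -> compact (closure A).
Proof.
move=> /bounded_closure_enorm[rho rho0 rhoA].
apply: bounded_closed_compact; last exact: closed_closure.
exists rho; split; first exact: num_real.
move=> t rt x Ax; apply: le_trans (norm_le_enorm x) _.
exact: le_trans (rhoA _ Ax) (ltW rt).
Qed.

Lemma boundary_open A : open A -> boundary A = closure A `\` A.
Proof. by rewrite /boundary => /interior_id ->. Qed.

Lemma compact_boundary A : bounded_set A -> compact (boundary A).
Proof.
move=> bA; apply: (subclosed_compact _ (compact_closure_bounded bA)).
  rewrite /boundary setDE; apply: closedI; first exact: closed_closure.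
  exact/open_closedC/open_interior.
exact: subDsetl.
Qed.

(** At the last time the segment meets A it is in the closure of A, and it is not
    in the open set A, which it could not leave immediately. *)
Lemma segment_meets_boundary A x z : open A -> A x -> ~ A z ->
  exists2 t, 0 <= t <= 1 & boundary A (x + t *: (z - x)).
Proof.
move=> oA Ax nAz.
pose T := [set t : R | 0 <= t <= 1 /\ A (x + t *: (z - x))].
have T0 : T 0 by split; rewrite ?lexx ?ler01// scale0r addr0.
have T1 : ubound T 1 by move=> t [/andP[]].
have hs : has_sup T by split; [exists 0|exists 1].
have s01 : 0 <= sup T <= 1.
  by rewrite (ub_le_sup hs.2 T0)/= ge_sup//; exists 0.
exists (sup T) => //; rewrite boundary_open//; split.
  apply/closure_enormP => r r0.
  have e0 : 0 < r / (1 + enorm (z - x)).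
    by rewrite divr_gt0// ltr_pwDl// enorm_ge0.
  have [t [t01 At] ts] := sup_adherent e0 hs.
  exists (x + t *: (z - x)) => //.
  rewrite opprD addrACA subrr add0r -scalerBl enormZ.
  have tsup : t <= sup T by apply: ub_le_sup => //; exact: hs.2.
  rewrite ler0_norm ?subr_le0// opprB.
  move: ts; rewrite ltrBlDr -ltrBlDl ltr_pdivlMr ?ltr_pwDl ?enorm_ge0//.
  by have := enorm_ge0 (z - x); nra.
move=> As; have [r r0 rA] := open_enorm oA As.
have s1 : sup T < 1.
  rewrite lt_neqAle (andP s01).2 andbT; apply/eqP => s1.
  by apply: nAz; move: As; rewrite s1 scale1r addrC subrK.
pose e := Num.min (1 - sup T) (r / (1 + enorm (z - x))).
have zx := enorm_ge0 (z - x).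
have e0 : 0 < e by rewrite lt_min subr_gt0 s1 divr_gt0// ltr_pwDl.
pose t := sup T + e / 2.
suff /(ub_le_sup hs.2) : T t by rewrite /t; lra.
have e1 : e <= 1 - sup T by rewrite ge_min lexx.
split; first by rewrite /t; lra.
apply: rA; rewrite opprD addrACA subrr add0r -scalerBl enormZ.
rewrite /t addrAC subrr add0r gtr0_norm ?divr_gt0//.
have : e <= r / (1 + enorm (z - x)) by rewrite ge_min lexx orbT.
by rewrite ler_pdivlMr ?ltr_pwDl//; nra.
Qed.

End EuclidTopology.

(** * Caratheodory's theorem with separation *)

Section Caratheodory.
Variables (R : realType) (N : nat).
Implicit Types (x y p q w : 'rV[R]_N) (K : set 'rV[R]_N).

Definition weights (n : nat) (c : 'I_n -> R) : Prop :=
  (forall i, 0 <= c i) /\ \sum_i c i = 1.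

(** N + 2 points of an N-dimensional space are affinely dependent, so the
    weights can be moved along a dependence relation until one of them
    vanishes. *)
Lemma weights_reduction (c : 'I_N.+2 -> R) (y : 'I_N.+2 -> 'rV[R]_N) :
  weights c ->
  exists c' i0, [/\ weights c', \sum_i c' i *: y i = \sum_i c i *: y i
                  & c' i0 = 0].
Proof.
move=> [c0 c1].
pose A : 'M[R]_(N.+2, N + 1) := row_mx (\matrix_i y i) (const_mx 1).
have : ~~ row_free A.
  rewrite /row_free neq_ltn; apply/orP; left; rewrite ltnS.
  by apply: leq_trans (rank_leq_col _) _; rewrite addn1.
rewrite -kermx_eq0 => /rowV0Pn[mu /sub_kermxP].
rewrite mul_mx_row => /eqP; rewrite row_mx_eq0 => /andP[/eqP muy /eqP mu1] mun0.
have smu : \sum_i mu ord0 i = 0.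
  move/rowP/(_ ord0): mu1; rewrite !mxE => H; rewrite -[RHS]H.
  by apply: eq_bigr => i _; rewrite mxE mulr1.
have smuy : \sum_i mu ord0 i *: y i = 0.
  rewrite -[RHS]muy mulmx_sum_row; apply: eq_bigr => i _; by rewrite rowK.
have [i1 mui1] : exists i, 0 < mu ord0 i.
  apply: contrapT => nex.
  have mule i : mu ord0 i <= 0 by rewrite leNgt; apply/negP => H; apply: nex; exists i.
  move/negP: mun0; apply; apply/eqP/rowP => i; rewrite mxE.
  have := @psumr_eq0P _ _ predT (fun i => - mu ord0 i).
  rewrite sumrN smu oppr0 => H; apply/eqP; rewrite -oppr_eq0; apply/eqP/H => //.
  by move=> j _; rewrite oppr_ge0.
case: (@arg_minP _ _ _ i1 (fun i => 0 < mu ord0 i) (fun i => c i / mu ord0 i) mui1).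
move=> i0 mui0 i0min; set t := c i0 / mu ord0 i0.
have t0 : 0 <= t by rewrite divr_ge0// ltW.
exists (fun i => c i - t * mu ord0 i), i0; split; first split.
- move=> i; rewrite subr_ge0; have [mui|mui] := ltP 0 (mu ord0 i).
    by rewrite -ler_pdivlMr// i0min.
  by apply: le_trans (c0 i); rewrite mulr_ge0_le0.
- by rewrite big_split/= sumrN -mulr_sumr smu mulr0 subr0.
- under eq_bigr do rewrite scalerBl -scalerA.
  by rewrite sumrB -scaler_sumr smuy scaler0 subr0.
- by rewrite /t divfK ?subrr// gt_eqF.
Qed.

Lemma coord_row_continuous (T : ptopologicalType) n (j : 'I_n) :
  continuous (fun v : 'rV[T]_n => v ord0 j).
Proof.
move=> v B vB.
exists (fun _ j' => if j' == j then B else setT).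
  by move=> i j'; rewrite (ord1 i); case: eqP => [->//|_]; exact: filterT.
by move=> w /(_ ord0 j); rewrite eqxx.
Qed.

(** With a fixed number of points the weights and the points range over a compact
    set; this is why the number has to be bounded in advance. *)
Lemma nearest_combination n K p : K !=set0 -> compact K ->
  exists c (y : 'I_n.+1 -> 'rV[R]_N), [/\ weights c, forall i, K (y i) &
    forall c' (y' : 'I_n.+1 -> 'rV[R]_N), weights c' -> (forall i, K (y' i)) ->
      enorm (\sum_i c i *: y i - p) <= enorm (\sum_i c' i *: y' i - p)].
Proof.
move=> [k0 Kk0] cK.
pose X := ('rV[R]_n.+1 * 'rV['rV[R]_N]_n.+1)%type.
pose box : set X := [set v : 'rV[R]_n.+1 | forall i, `[(0 : R), 1]%classic (v ord0 i)]
  `*` [set v : 'rV['rV[R]_N]_n.+1 | forall i, K (v ord0 i)].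
have cbox : compact box.
  apply: compact_setX; last by apply: (@rV_compact _ n.+1 (fun=> K)).
  refine (@rV_compact R _ (fun=> `[(0 : R), 1]%classic) _) => _.
  exact: segment_compact.
pose S (v : X) : R := \sum_i v.1 ord0 i.
have cont1 i : continuous (fun v : X => v.1 ord0 i).
  move=> v; apply: (@continuous_comp _ _ _ fst (fun w : 'rV[R]_n.+1 => w ord0 i)).
    exact: cvg_fst.
  exact: coord_row_continuous.
have cont2 i : continuous (fun v : X => v.2 ord0 i).
  move=> v.
  apply: (@continuous_comp _ _ _ snd (fun w : 'rV['rV[R]_N]_n.+1 => w ord0 i)).
    exact: cvg_snd.
  exact: coord_row_continuous.
have contS : continuous S.
  apply: continuous_big => [|i _]; [exact: add_continuous|exact: cont1].
pose P (v : X) : 'rV[R]_N := \sum_i v.1 ord0 i *: v.2 ord0 i.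
have contP : continuous P.
  apply: continuous_big => [|i _]; first exact: add_continuous.
  by move=> v; apply: cvgZ; [exact: cont1|exact: cont2].
pose dom := box `&` [set v | S v = 1].
have cdom : compact dom.
  apply: compact_closedI => //.
  by apply: (@preimage_closed _ _ S [set 1]) => [v _|]; [exact: contS|exact: closed_eq].
have dom0 : dom !=set0.
  exists (\row_i (if i == ord0 then 1 else 0), \row_i k0); split.
    split=> i; rewrite mxE//.
    by case: eqP; rewrite /= in_itv/= ?lexx ?ler01.
  rewrite /= /S (bigD1 ord0)//= mxE eqxx big1 ?addr0// => i i0.
  by rewrite mxE (negPf i0).
have contF : {within dom, continuous (fun v => enorm (P v - p))}.
  apply: continuous_subspaceT => v.
  apply: (@continuous_comp _ _ _ P (fun q => enorm (q - p))); first exact: contP.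
  exact: enormB_continuous.
have [v] := compact_EVT_min dom0 cdom contF.
rewrite inE => -[[vbox vK] vS] vmin.
exists (fun i => v.1 ord0 i), (fun i => v.2 ord0 i); split => //.
  by split=> // i; have := vbox i; rewrite /= in_itv/= => /andP[].
move=> c' y' [c'0 c'1] Ky'.
have -> : \sum_i c' i *: y' i = P (\row_i c' i, \row_i y' i).
  by apply: eq_bigr => i _; rewrite !mxE.
apply: vmin; rewrite inE; split.
  split=> i; rewrite mxE//= in_itv/= c'0 -c'1.
  by rewrite (bigD1 i)//= lerDl sumr_ge0.
by rewrite /= /S -c'1; apply: eq_bigr => i _; rewrite mxE.
Qed.

(** Take for q a combination of N + 2 points of K that is nearest to p. One of the
    points can be given the weight zero and then be replaced by any k in K, so
    that q can be moved towards k; by minimality this does not bring it nearer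
    to p. *)
Lemma caratheodory_separation K p : K !=set0 -> compact K ->
  (exists c (y : 'I_N.+2 -> 'rV[R]_N),
     [/\ weights c, forall i, K (y i) & p = \sum_i c i *: y i]) \/
  (exists2 q, p != q & forall k, K k -> dotp (k - q) (p - q) <= 0).
Proof.
move=> K0 cK.
have [c [y [wc Ky ymin]]] := nearest_combination N.+1 p K0 cK.
have [c' [i0 [wc' c'c c'0]]] := weights_reduction y wc.
set q := \sum_i c i *: y i in c'c ymin.
have [pq|pq] := eqVneq p q; [left; by exists c, y | right].
exists q => // k Kk; rewrite leNgt; apply/negP => pos.
pose s := dotp (k - q) (k - q).
have s0 : 0 <= s := dotp_ge0 _.
pose g := dotp (k - q) (p - q).
pose t := Num.min 1 (g / (s + 1)).
have t0 : 0 < t by rewrite lt_min ltr01 divr_gt0// ltr_wpDl.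
have t1 : t <= 1 by rewrite ge_min lexx.
pose c2 i := (1 - t) * c' i + (if i == i0 then t else 0).
pose y2 i := if i == i0 then k else y i.
have wc2 : weights c2.
  split=> [i|].
    rewrite addr_ge0 ?mulr_ge0 ?subr_ge0 ?wc'.1//.
    by case: eqP => _ //; exact: ltW.
  rewrite big_split/= -mulr_sumr wc'.2 mulr1 -big_mkcond/= big_pred1_eq; ring.
have Ky2 i : K (y2 i) by rewrite /y2; case: eqP.
have E : \sum_i c2 i *: y2 i = q + t *: (k - q).
  rewrite (bigD1 i0)//= /c2 /y2 eqxx c'0 mulr0 add0r.
  under eq_bigr => i ii0 do rewrite (negPf ii0) addr0 -scalerA.
  rewrite -scaler_sumr.
  have -> : \sum_(i < N.+2 | i != i0) c' i *: y i = q.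
    by rewrite -c'c [RHS](bigD1 i0)//= c'0 scale0r add0r.
  by rewrite scalerBr scalerBl scale1r addrC -addrA (addrC (- _)) addrA.
have := ymin _ _ wc2 Ky2; rewrite E.
rewrite -(@ler_pXn2r _ 2)// ?nnegrE ?enorm_ge0// !sqr_enorm.
have -> : q + t *: (k - q) - p = t *: (k - q) - (p - q).
  by rewrite opprB addrCA addrA.
rewrite -(opprB p q) [X in _ <= X](_ : _ = t ^+ 2 * s - 2 * t * g + dotp (p - q) (p - q)).
  rewrite dotpNl dotpNr opprK -subr_ge0 addrK => H.
  have : t <= g / (s + 1) by rewrite ge_min lexx orbT.
  rewrite ler_pdivlMr ?ltr_wpDl// => ts.
  have : t * (t * s - 2 * g) >= 0 by move: H; rewrite /g; nra.
  rewrite pmulr_rge0// /g => H2.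
  have : t * s <= g by nra.
  rewrite /g; lra.
by rewrite dotp_sqrB !dotpZr !dotpZl -/g -/s; ring.
Qed.

End Caratheodory.

(** * Convex combinations and the convex envelope *)

Section Jensen.
Variables (R : realType) (d : nat).
Implicit Types (x y : 'rV[R]_d) (Om : set 'rV[R]_d).

Lemma affine_sum (l : 'rV[R]_d -> R) n (c : 'I_n -> R) (p : 'I_n -> 'rV[R]_d) :
  affine_fun l -> \sum_i c i = 1 ->
  l (\sum_i c i *: p i) = \sum_i c i * l (p i).
Proof.
move=> [a [b lE]] c1; rewrite lE dotp_sumr -[b]mul1r -c1 mulr_suml -big_split.
by apply: eq_bigr => i _ /=; rewrite lE dotpZr mulrDr.
Qed.

Lemma weights_sum_const n (c : 'I_n -> R) x : weights c -> \sum_i c i *: x = x.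
Proof. by move=> [_ c1]; rewrite -scaler_suml c1 scale1r. Qed.

Lemma weights_le n (c : 'I_n -> R) (g h : 'I_n -> R) : weights c ->
  (forall i, 0 < c i -> g i <= h i) -> \sum_i c i * g i <= \sum_i c i * h i.
Proof.
move=> [c0 _] gh; apply: ler_sum => i _.
have := c0 i; rewrite le_eqVlt => /orP[/eqP<-|ci]; first by rewrite !mul0r.
by rewrite ler_pM2l// gh.
Qed.

Lemma weights_avg_le n (c : 'I_n -> R) (g : 'I_n -> R) (b : R) : weights c ->
  (forall i, 0 < c i -> g i <= b) -> \sum_i c i * g i <= b.
Proof.
move=> wc gb; apply: le_trans (weights_le wc gb) _.
by rewrite -mulr_suml wc.2 mul1r.
Qed.

Definition convex_closed (A : set 'rV[R]_d) : Prop :=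
  forall x y t, A x -> A y -> 0 <= t <= 1 -> A (t *: x + (1 - t) *: y).

Lemma convex_combination (A : set 'rV[R]_d) n (c : 'I_n -> R)
    (p : 'I_n -> 'rV[R]_d) : convex_closed A ->
  weights c -> (forall i, A (p i)) -> A (\sum_i c i *: p i).
Proof.
move=> cA; elim: n c p => [|n IH] c p [c0 c1] Ap.
  by move: c1; rewrite big_ord0 => /esym/eqP; rewrite oner_eq0.
rewrite big_ord_recl; have [e1|ne1] := eqVneq (c ord0) 1.
  have H i : c (lift ord0 i) = 0.
    apply: (@psumr_eq0P _ _ predT (fun i => c (lift ord0 i))) => //.
    by move: c1; rewrite big_ord_recl e1 => /(canRL (addKr _)); rewrite addrC subrr.
  by rewrite e1 scale1r big1 ?addr0// => i _; rewrite H scale0r.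
have s1 : \sum_(i < n) c (lift ord0 i) = 1 - c ord0.
  by rewrite -c1 big_ord_recl addrAC subrr add0r.
have c01 : c ord0 <= 1 by rewrite -subr_ge0 -s1 sumr_ge0.
have c02 : 0 < 1 - c ord0 by rewrite subr_gt0 lt_neqAle ne1.
have -> : \sum_(i < n) c (lift ord0 i) *: p (lift ord0 i) = (1 - c ord0) *:
    \sum_(i < n) (c (lift ord0 i) / (1 - c ord0)) *: p (lift ord0 i).
  rewrite scaler_sumr; apply: eq_bigr => i _.
  by rewrite scalerA mulrC divfK// gt_eqF.
apply: cA => //; last by rewrite c0.
apply: IH => //; split => [i|]; first by rewrite divr_ge0// ltW.
by rewrite -mulr_suml s1 divff// gt_eqF.
Qed.

Lemma strictly_convex_closure Om : strictly_convex Om -> convex_closed (closure Om).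
Proof.
move=> sc x y t cx cy /andP[t0 t1].
have [->|xy] := eqVneq x y; first by rewrite -scalerDl addrC subrK scale1r.
move: t0; rewrite le_eqVlt => /orP[/eqP<-|t0].
  by rewrite scale0r subr0 scale1r add0r.
move: t1; rewrite le_eqVlt => /orP[/eqP->|t1].
  by rewrite subrr scale0r scale1r addr0.
by apply: subset_closure; apply: sc => //; rewrite t0.
Qed.

(** A point of positive weight other than x would make x an inner point of the
    segment from it to the mean of the other points, hence a point of Om. *)
Lemma strictly_convex_extreme Om n (c : 'I_n -> R) (p : 'I_n -> 'rV[R]_d) x :
  open Om -> strictly_convex Om -> boundary Om x -> weights c ->
  (forall i, closure Om (p i)) -> x = \sum_i c i *: p i ->
  forall i, 0 < c i -> p i = x.
Proof.
move=> oO sc bx [c0 c1] cp xE i ci.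
have s1 : \sum_(j | j != i) c j = 1 - c i.
  by rewrite -c1 [in RHS](bigD1 i)//= addrAC subrr add0r.
have ci1 : c i <= 1 by rewrite -subr_ge0 -s1 sumr_ge0.
move: ci1; rewrite le_eqVlt => /orP[/eqP e1|ci1].
  have H j : j != i -> c j = 0.
    apply: (@psumr_eq0P _ _ (fun j => j != i) c) => //.
    by rewrite s1 e1 subrr.
  rewrite xE (bigD1 i)//= e1 scale1r big1 ?addr0// => j ji.
  by rewrite H// scale0r.
have c02 : 0 < 1 - c i by rewrite subr_gt0.
pose c' j := if j == i then 0 else c j / (1 - c i).
have wc' : weights c'.
  split=> [j|]; first by rewrite /c'; case: eqP => // _; rewrite divr_ge0// ltW.
  rewrite (bigD1 i)//= /c' eqxx add0r.
  under eq_bigr => j ji do rewrite (negPf ji).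
  by rewrite -mulr_suml s1 divff// gt_eqF.
pose q := \sum_j c' j *: p j.
have cq : closure Om q.
  apply: convex_combination => //; exact: strictly_convex_closure.
have xE2 : x = c i *: p i + (1 - c i) *: q.
  rewrite xE (bigD1 i)//= /q; congr (_ + _).
  rewrite scaler_sumr [RHS](bigD1 i)//= /c' eqxx scale0r scaler0 add0r.
  apply: eq_bigr => j ji; rewrite (negPf ji) scalerA mulrC divfK// gt_eqF//.
have [pq|pq] := eqVneq (p i) q.
  by rewrite xE2 -pq -scalerDl addrC subrK scale1r.
have : Om x by rewrite xE2; apply: sc => //; rewrite ci.
by move: bx; rewrite boundary_open// => -[].
Qed.

End Jensen.

Section Envelope.
Variables (R : realType) (d : nat) (Om : set 'rV[R]_d) (f : 'rV[R]_d -> R).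
Hypotheses (oO : open Om) (bO : bounded_set Om) (scO : strictly_convex Om).
Hypothesis cf : {within closure Om, continuous f}.
Implicit Types (x y : 'rV[R]_d).

Lemma continuous_graph :
  {within closure Om, continuous (fun y => row_mx y (f y)%:M)}.
Proof.
pose e (j : 'I_(d + 1)) : 'rV[R]_(d + 1) := delta_mx ord0 j.
have -> : (fun y => row_mx y (f y)%:M) =
   (fun y => (\sum_j y ord0 j *: e (lshift 1 j)) + f y *: e (rshift d ord0)).
  apply/funext => y; rewrite [LHS]row_sum_delta big_split_ord big_ord1/=.
  congr (_ + _); last by rewrite row_mxEr mxE.
  by apply: eq_bigr => j _; rewrite row_mxEl.
move=> y; apply: cvgD.
  apply: cvg_big => [|j _]; first exact: add_continuous.
  apply: cvgZl; apply: continuous_subspaceT; exact: coord_row_continuous.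
by apply: cvgZl; exact: cf.
Qed.

Lemma dotp_row_mx (a a' : 'rV[R]_d) (b b' : 'rV[R]_1) :
  dotp (row_mx a b) (row_mx a' b') = dotp a a' + b ord0 ord0 * b' ord0 ord0.
Proof.
rewrite /dotp big_split_ord big_ord1/= !row_mxEr; congr (_ + _).
by apply: eq_bigr => i _; rewrite !row_mxEl.
Qed.

Lemma envelope_set_neq0 x : closure Om x ->
  [set l x | l in [set l | affine_fun l /\
                               forall y, closure Om y -> l y <= f y]] !=set0.
Proof.
move=> cx; have cc := compact_closure_bounded bO.
have [z _ zmin] := compact_EVT_min (ex_intro _ x cx) cc cf.
exists (f z), (fun=> f z) => //; split.
  by exists 0, (f z) => y; rewrite -(scale0r 0) dotpZl mul0r add0r.
by move=> y cy; apply: zmin; rewrite inE.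
Qed.

Lemma envelope_le x : closure Om x -> convex_envelope Om f x <= f x.
Proof.
move=> cx; apply: ge_sup; first exact: envelope_set_neq0.
by move=> _ [l [_ lf] <-]; exact: lf.
Qed.

Lemma envelope_ge x l : closure Om x -> affine_fun l ->
  (forall y, closure Om y -> l y <= f y) -> l x <= convex_envelope Om f x.
Proof.
move=> cx al lf; apply: ub_le_sup; last by exists l.
by exists (f x) => _ [l' [_ lf'] <-]; exact: lf'.
Qed.

(** Every affine minorant of f satisfies it, with equality. *)
Lemma envelope_jensen n (c : 'I_n -> R) (p : 'I_n -> 'rV[R]_d) : weights c ->
  (forall i, closure Om (p i)) ->
  convex_envelope Om f (\sum_i c i *: p i) <=
  \sum_i c i * convex_envelope Om f (p i).
Proof.
move=> wc cp; have cs : closure Om (\sum_i c i *: p i).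
  apply: convex_combination => //; exact: strictly_convex_closure.
apply: ge_sup; first exact: envelope_set_neq0.
move=> _ [l [al lf] <-]; rewrite (affine_sum _ al wc.2).
by apply: weights_le => // i _; exact: envelope_ge.
Qed.

(** Otherwise the compact graph of f could be strictly separated from the point
    (x, u x) by a hyperplane, which cannot be vertical because x lies in the
    closure of Om; it would be the graph of an affine minorant above u x. *)
Lemma envelope_attained x : closure Om x ->
  exists c (y : 'I_(d + 1).+2 -> 'rV[R]_d),
    [/\ weights c, forall i, closure Om (y i), x = \sum_i c i *: y i
      & convex_envelope Om f x = \sum_i c i * f (y i)].
Proof.
move=> cx; set u := convex_envelope Om f x.
pose F y : 'rV[R]_(d + 1) := row_mx y (f y)%:M.
have cK : compact (F @` closure Om).
  apply: continuous_compact; first exact: continuous_graph.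
  exact: compact_closure_bounded.
have K0 : F @` closure Om !=set0 by exists (F x), x.
have [[c [y [wc Ky pE]]]|[q pq sep]] :=
    caratheodory_separation (row_mx x u%:M) K0 cK.
  have /choice[z zP] i : exists z, closure Om z /\ F z = y i.
    by have [z cz zy] := Ky i; exists z.
  exists c, z; split => //; first by move=> i; have [] := zP i.
    have := congr1 lsubmx pE; rewrite row_mxKl linear_sum => ->.
    by apply: eq_bigr => i _; rewrite linearZ -(zP i).2 /F /= row_mxKl.
  have := congr1 (fun v : 'rV[R]_(d + 1) => v ord0 (rshift d ord0)) pE.
  rewrite row_mxEr mxE eqxx mulr1n summxE => ->.
  by apply: eq_bigr => i _; rewrite mxE -(zP i).2 /F row_mxEr mxE.
exfalso; set p := row_mx x u%:M in pq sep.
pose w := lsubmx (p - q); pose b := rsubmx (p - q) ord0 ord0.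
have gap0 : 0 < dotp (p - q) (p - q).
  by rewrite -sqr_enorm exprn_gt0// enorm_gt0 subr_eq0.
set g := dotp (p - q) (p - q) in gap0.
have key y : closure Om y -> dotp (y - x) w + (f y - u) * b <= - g.
  move=> cy; have := sep (F y) (imageP _ cy).
  have -> : F y - q = (F y - p) + (p - q) by rewrite addrA subrK.
  rewrite dotpDl -/g => H.
  have : dotp (F y - p) (p - q) <= - g by lra.
  rewrite -[p - q]hsubmxK /F /p -[X in X - row_mx _ _]/(row_mx y (f y)%:M).
  rewrite opp_row_mx add_row_mx dotp_row_mx -/w.
  have -> : ((f y)%:M - u%:M : 'rV[R]_1) ord0 ord0 = f y - u.
    by rewrite !mxE eqxx !mulr1n.
  exact.
have b0 : b < 0.
  have := key x cx; rewrite subrr -(scale0r 0) dotpZl mul0r add0r => H.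
  rewrite ltNge; apply/negP => b0.
  have : 0 <= (f x - u) * b by rewrite mulr_ge0// subr_ge0 envelope_le.
  lra.
pose l y := dotp (- b^-1 *: w) y + (u + b^-1 * (dotp x w - g)).
have lE y : l y = u - b^-1 * (dotp (y - x) w + g).
  by rewrite /l dotpZl dotpBl (dotpC w y); ring.
have bV : b^-1 * b = 1 by rewrite mulVf// lt_eqF.
have bV0 : b^-1 < 0 by rewrite invr_lt0.
have : l x <= u.
  apply: envelope_ge => //; first by exists (- b^-1 *: w), (u + b^-1 * (dotp x w - g)).
  move=> y cy; rewrite lE; have := key y cy => H.
  have : b^-1 * (dotp (y - x) w + g) >= b^-1 * - ((f y - u) * b).
    by rewrite ler_nM2l//; lra.
  rewrite mulrN mulrCA bV mulr1; lra.
rewrite lE subrr -(scale0r 0) dotpZl mul0r add0r.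
have : b^-1 * g < 0 by rewrite nmulr_rlt0.
lra.
Qed.

(** The point x is extreme, so that all points of positive weight in
    [envelope_attained] coincide with x. *)
Lemma envelope_boundary x : boundary Om x -> convex_envelope Om f x = f x.
Proof.
move=> bx; have cx : closure Om x by case: bx.
have [c [y [wc cy xE ->]]] := envelope_attained cx.
have yE := strictly_convex_extreme oO scO bx wc cy xE.
rewrite -[RHS]mul1r -wc.2 mulr_suml; apply: eq_bigr => i _.
have := wc.1 i; rewrite le_eqVlt => /orP[/eqP<-|ci]; first by rewrite !mul0r.
by rewrite yE.
Qed.

End Envelope.

(** * Taylor's formula from Hoelder continuous partial derivatives *)

Section RealLemmas.
Variable R : realType.

Lemma le_of_le_addpowR (A B C r alpha : R) : 0 < alpha -> 0 < r ->
  (forall t, 0 < t < r -> A <= B + C * t `^ alpha) -> A <= B.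
Proof.
move=> a0 r0 H; rewrite leNgt; apply/negP => BA.
pose e := (A - B) / (2 * (`|C| + 1)).
have C0 := normr_ge0 C; have C1 := ler_norm C.
have e0 : 0 < e by rewrite divr_gt0// ?subr_gt0// mulr_gt0// ltr_wpDl.
pose t := Num.min (r / 2) (e `^ alpha^-1).
have t0 : 0 < t by rewrite lt_min powR_gt0// andbT divr_gt0.
have tr : t < r by rewrite gt_min; apply/orP; left; lra.
have te : t `^ alpha <= e.
  have -> : e = (e `^ alpha^-1) `^ alpha.
    by rewrite -powRrM mulVf ?gt_eqF// powRr1// ltW.
  apply: ge0_ler_powR; rewrite ?nnegrE ?powR_ge0 ?(ltW t0) ?(ltW a0)//.
  by rewrite ge_min lexx orbT.
have := H t; rewrite t0 tr => /(_ isT).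
have : C * t `^ alpha <= (`|C| + 1) * e.
  have := powR_ge0 t alpha; nra.
have -> : (`|C| + 1) * e = (A - B) / 2.
  by rewrite /e; field; lra.
lra.
Qed.

(** Symmetric in the sign of t, as moves along a coordinate axis go both ways. *)
Lemma mvt_centered (phi dphi : R -> R) (t : R) :
  (forall tau : R, `|tau| <= `|t| -> is_derive tau (1 : R) phi (dphi tau)) ->
  exists2 tau, `|tau| <= `|t| & phi t - phi 0 = dphi tau * t.
Proof.
move=> H.
have cont (a b : R) : (forall x, x \in `[a, b] -> `|x| <= `|t|) ->
    {within `[a, b], continuous phi}.
  move=> ab; apply: derivable_within_continuous => x /ab /H dx.
  exact: ex_derive.
have [t0|t0] := leP 0 t.
  have sub x : x \in `[0, t] -> `|x| <= `|t|.
    by rewrite in_itv/= => /andP[x0 xt]; rewrite !ger0_norm.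
  have der x : x \in `]0, t[ -> is_derive x (1 : R) phi (dphi x).
    move=> x0t; apply: H; apply: sub.
    by move: x0t; rewrite !in_itv/= => /andP[/ltW-> /ltW->].
  have [c c0t E] := MVT_segment t0 der (cont _ _ sub).
  by exists c; rewrite ?sub// E subr0.
have sub x : x \in `[t, 0] -> `|x| <= `|t|.
  by rewrite in_itv/= => /andP[xt x0]; rewrite !ler0_norm ?(ltW t0)// lerN2.
have der x : x \in `]t, 0[ -> is_derive x (1 : R) phi (dphi x).
  move=> x0t; apply: H; apply: sub.
  by move: x0t; rewrite !in_itv/= => /andP[/ltW-> /ltW->].
have [c c0t E] := MVT_segment (ltW t0) der (cont _ _ sub).
exists c; first exact: sub.
by rewrite -opprB E sub0r mulrN opprK.
Qed.

End RealLemmas.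

Section Taylor.
Variables (R : realType) (d : nat).
Implicit Types (x y p v : 'rV[R]_d) (g : 'rV[R]_d -> R).

Lemma is_derive_line g p v (t : R) : derivable g (p + t *: v) v ->
  is_derive t 1 (fun tau : R => g (p + tau *: v)) ('D_v g (p + t *: v)).
Proof.
set phi := (fun tau : R => g (p + tau *: v)).
have E : (fun h : R => h^-1 *: ((phi \o shift t) (h *: (1 : R)) - phi t)) =
         (fun h => h^-1 *: ((g \o shift (p + t *: v)) (h *: v) - g (p + t *: v))).
  apply/funext => h; rewrite /phi /=; congr (_ *: (g _ - _)).
  by rewrite [h *: 1]mulr1 scalerDl addrCA addrA.
by move=> dg; split; rewrite /derivable /derive E.
Qed.

Definition grad g x : 'rV[R]_d := \row_i 'D_(delta_mx ord0 i) g x.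

Variables (Om : set 'rV[R]_d) (g : 'rV[R]_d -> R) (s alpha : R).
Hypotheses (oO : open Om) (cO : convex_closed Om) (s0 : 0 <= s) (a0 : 0 < alpha).
Hypothesis dg : forall x i, Om x -> derivable g x (delta_mx ord0 i).
Hypothesis hg : forall x y i, Om x -> Om y ->
  `|grad g x ord0 i - grad g y ord0 i| <= s * enorm (x - y) `^ alpha.

Lemma enorm_le_coord x y : (forall i, `|x ord0 i| <= `|y ord0 i|) ->
  enorm x <= enorm y.
Proof.
move=> xy; rewrite ler_sqrt ?dotp_ge0//; apply: ler_sum => i _.
by rewrite -!expr2 -[leLHS]real_normK ?num_real// -[leRHS]real_normK ?num_real// ler_sqr.
Qed.

Lemma dotp_coord_le x (c : R) (w : 'rV[R]_d) : 0 <= c ->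
  (forall i, `|w ord0 i| <= c) -> `|dotp w x| <= d%:R * c * enorm x.
Proof.
move=> c0 wc; apply: le_trans (ler_norm_sum _ _ _) _.
rewrite -[d in d%:R]card_ord mulr_natl mulrnAl -sumr_const.
apply: ler_sum => i _; rewrite normrM; apply: ler_pM => //.
exact: enorm_coord.
Qed.

Lemma powR1D (r : R) : 0 <= r -> r `^ (1 + alpha) = r `^ alpha * r.
Proof.
move=> r0; rewrite powRD; first by rewrite powRr1// mulrC.
by rewrite gt_eqF// addr_gt0.
Qed.

(** Only partial derivatives are given, so y is reached from x along the
    coordinate axes. This path stays in a ball around x, but might leave Om if y
    were far away. *)
Lemma taylor_local x : Om x ->
  exists2 r, 0 < r & forall y, enorm (y - x) < r ->
    `|g y - g x - dotp (grad g x) (y - x)|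
    <= d%:R * s * enorm (y - x) `^ (1 + alpha).
Proof.
move=> Ox; have [r r0 rO] := open_enorm oO Ox; exists r => // y yx.
pose X (m : nat) : 'rV[R]_d := \row_i (if (i < m)%N then y ord0 i else x ord0 i).
have X0 : X 0%N = x by apply/rowP => i; rewrite mxE.
have Xd : X d = y by apply/rowP => i; rewrite mxE ltn_ord.
have tel : g y - g x = \sum_(m < d) (g (X m.+1) - g (X m)).
  by rewrite -X0 -{1}Xd -(big_mkord predT (fun m => g (X m.+1) - g (X m))) telescope_sumr.
have XS (m : 'I_d) : X m.+1 = X m + (y - x) ord0 m *: delta_mx ord0 m.
  apply/rowP => i; rewrite !mxE eqxx /=; have [->|im] := eqVneq i m.
    by rewrite ltnSn ltnn mulr1; ring.
  by rewrite mulr0 addr0 ltnS leq_eqVlt (negPf (im : (i : nat) != m)).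
have near (m : 'I_d) (tau : R) : `|tau| <= `|(y - x) ord0 m| ->
    enorm (X m + tau *: delta_mx ord0 m - x) <= enorm (y - x).
  move=> tm; apply: enorm_le_coord => i; rewrite !mxE eqxx /=.
  have [->|im] := eqVneq i m.
    by move: tm; rewrite !mxE ltnn mulr1 addrAC subrr add0r.
  by rewrite mulr0 addr0; case: ifP => // _; rewrite subrr normr0.
have step (m : 'I_d) : `|g (X m.+1) - g (X m) - grad g x ord0 m * (y - x) ord0 m|
    <= s * enorm (y - x) `^ alpha * enorm (y - x).
  have inO (tau : R) : `|tau| <= `|(y - x) ord0 m| ->
      Om (X m + tau *: delta_mx ord0 m).
    by move=> /near H; apply: rO; exact: le_lt_trans H yx.
  have [|tau taum] := @mvt_centered _
      (fun tau => g (X m + tau *: delta_mx ord0 m))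
      (fun tau => 'D_(delta_mx ord0 m) g (X m + tau *: delta_mx ord0 m))
      ((y - x) ord0 m).
    by move=> tau taum; apply: is_derive_line; apply: dg; exact: inO.
  rewrite scale0r addr0 -XS => ->.
  rewrite -mulrBl normrM; apply: ler_pM => //; last exact: enorm_coord.
  have := hg m (inO _ taum) Ox; rewrite !mxE => /le_trans; apply.
  rewrite ler_wpM2l//; apply: ge0_ler_powR; rewrite ?nnegrE ?enorm_ge0 ?(ltW a0)//.
  exact: near.
rewrite tel /dotp -sumrB; apply: le_trans (ler_norm_sum _ _ _) _.
apply: (@le_trans _ _ (\sum_(i < d) s * enorm (y - x) `^ alpha * enorm (y - x))).
  exact: ler_sum.
by rewrite sumr_const card_ord powR1D ?enorm_ge0// -[leLHS]mulr_natl !mulrA.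
Qed.

(** By [taylor_local] the difference quotients converge at the rate [alpha]. *)
Lemma is_derive_grad p v (t : R) : Om (p + t *: v) ->
  is_derive t 1 (fun tau : R => g (p + tau *: v)) (dotp (grad g (p + t *: v)) v).
Proof.
move=> Oq; set q := p + t *: v in Oq *.
have [r r0 T] := taylor_local Oq.
set phi := (fun tau : R => g (p + tau *: v)).
suff L : (fun h : R => h^-1 *: ((phi \o shift t) (h *: (1 : R)) - phi t)) @ 0^'
    --> (dotp (grad g q) v : R).
  split; first by apply/cvg_ex; exists (dotp (grad g q) v).
  exact: (cvg_lim _ L).
apply/cvgrPdist_le => e e0.
pose C := d%:R * s * enorm v `^ (1 + alpha).
have C0 : 0 <= C by rewrite !mulr_ge0// powR_ge0.
pose b := Num.min (r / (enorm v + 1)) ((e / (C + 1)) `^ alpha^-1).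
have b0 : 0 < b.
  by rewrite lt_min powR_gt0 ?divr_gt0// ?ltr_wpDl// enorm_ge0.
near=> h.
have h0 : h != 0 by near: h; exact: nbhs_dnbhs_neq.
have hb : `|h| < b.
  near: h; apply: nbhs_dnbhs; exists b => //= z.
  by rewrite /ball_/= sub0r normrN.
have qE : p + (h + t) *: v = q + h *: v.
  by rewrite /q scalerDl (addrC (h *: v)) addrA.
rewrite /phi /= [h *: 1]mulr1 qE -/q.
have qq : q + h *: v - q = h *: v by rewrite addrAC subrr add0r.
have hv : enorm (q + h *: v - q) < r.
  rewrite qq enormZ.
  have : `|h| < r / (enorm v + 1) by apply: lt_le_trans hb _; rewrite ge_min lexx.
  rewrite ltr_pdivlMr ?ltr_wpDl ?enorm_ge0//.
  by have := normr_ge0 h; nra.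
have := T _ hv; rewrite qq enormZ dotpZr => H.
rewrite -normrN opprB -[X in `|_ - X|](mulKf h0) -mulrBr normrM normfV.
rewrite ler_pdivrMl ?normr_gt0//; apply: (le_trans H).
rewrite powRM ?enorm_ge0// powR1D// mulrA (mulrAC _ _ (enorm v `^ _)) mulrA.
rewrite mulrC ler_pM2l ?normr_gt0//.
have ha : `|h| `^ alpha <= e / (C + 1).
  have -> : e / (C + 1) = ((e / (C + 1)) `^ alpha^-1) `^ alpha.
    by rewrite -powRrM mulVf ?gt_eqF// powRr1// divr_ge0 ?ltW// ltr_wpDl.
  apply: ge0_ler_powR; rewrite ?nnegrE ?powR_ge0// ltW//.
  by apply: lt_le_trans hb _; rewrite ge_min lexx orbT.
have : C * `|h| `^ alpha <= C * (e / (C + 1)) by rewrite ler_wpM2l.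
have -> : C * (e / (C + 1)) = e - e / (C + 1) by field; lra.
have : 0 < e / (C + 1) by rewrite divr_gt0// ltr_wpDl.
rewrite /C; lra.
Unshelve. all: by end_near. Qed.

(** The mean value theorem along the segment from x to y, which lies in the convex
    set Om. *)
Lemma taylor x y : Om x -> Om y ->
  `|g y - g x - dotp (grad g x) (y - x)|
  <= d%:R * s * enorm (y - x) `^ (1 + alpha).
Proof.
move=> Ox Oy.
have inO (t : R) : t \in `[0, 1] -> Om (x + t *: (y - x)).
  rewrite in_itv/= => /andP[t0 t1].
  have -> : x + t *: (y - x) = t *: y + (1 - t) *: x.
    by rewrite scalerBr scalerBl scale1r addrCA addrA addrC addrA.
  by apply: cO => //; rewrite t0.
have [|//|t t01] := @MVT_segment R (fun t => g (x + t *: (y - x)))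
   (fun t => dotp (grad g (x + t *: (y - x))) (y - x)) 0 1 ler01.
  move=> t t01; apply: is_derive_grad; apply: inO.
  by move: t01; rewrite !in_itv/= => /andP[/ltW-> /ltW->].
  apply: derivable_within_continuous => t /inO Ot.
  exact: (@ex_derive _ _ _ _ _ _ _ (is_derive_grad Ot)).
rewrite scale0r addr0 scale1r (addrC x) subrK subr0 mulr1 => ->.
rewrite -dotpBl powR1D ?enorm_ge0// mulrA -(mulrA d%:R).
have /andP[t0 t1] : 0 <= t <= 1 by move: t01; rewrite in_itv.
apply: dotp_coord_le => [|i]; first by rewrite mulr_ge0// powR_ge0.
rewrite mxE [X in _ + X]mxE.
apply: le_trans (hg i (inO _ t01) Ox) _.
rewrite ler_wpM2l//; apply: ge0_ler_powR; rewrite ?nnegrE ?enorm_ge0 ?(ltW a0)//.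
rewrite addrAC subrr add0r enormZ ger0_norm//.
by have := enorm_ge0 (y - x); nra.
Qed.

(** Convexity bounds g from above on a short segment starting at x; compare with
    [taylor_local] and divide by the length. *)
Lemma subgradient x y : Om x ->
  (forall t, 0 < t < 1 -> g (x + t *: (y - x)) <= (1 - t) * g x + t * g y) ->
  g x + dotp (grad g x) (y - x) <= g y.
Proof.
move=> Ox H; have [r r0 T] := taylor_local Ox.
have n0 := enorm_ge0 (y - x).
have n1 : 0 < enorm (y - x) + 1 by rewrite ltr_wpDl.
rewrite addrC -lerBrDr.
apply: (@le_of_le_addpowR _ _ _ (d%:R * s * enorm (y - x) `^ (1 + alpha))
  (Num.min 1 (r / (enorm (y - x) + 1))) alpha a0).
  by rewrite lt_min ltr01 divr_gt0.
move=> t /andP[t0]; rewrite lt_min => /andP[t1]; rewrite ltr_pdivlMr// => tr.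
have E : x + t *: (y - x) - x = t *: (y - x) by rewrite addrAC subrr add0r.
have tr' : t * enorm (y - x) < r by nra.
have := H t; rewrite t0 t1 => /(_ isT) Ht.
have := T (x + t *: (y - x)); rewrite E enormZ gtr0_norm// => /(_ tr').
rewrite dotpZr ler_norml powRM ?(ltW t0)// powR1D ?(ltW t0)// => /andP[T1 _].
rewrite -(ler_pM2l t0); nra.
Qed.

(** A step from p in the direction [a - grad g p] lowers the difference of g and the
    affine function at first order, whereas [taylor_local] has a smaller error. *)
Lemma touching_gradient p (a : 'rV[R]_d) : Om p ->
  (forall q, Om q -> g p + dotp a (q - p) <= g q) -> grad g p = a.
Proof.
move=> Op H; have [r1 r10 T] := taylor_local Op.
have [r2 r20 rO] := open_enorm oO Op.
pose w := a - grad g p.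
suff : dotp w w <= 0.
  rewrite -sqr_enorm => w0; apply/esym/eqP; rewrite -subr_eq0 -/w -enorm_eq0.
  by have : enorm w ^+ 2 == 0 by [rewrite eq_le w0 sqr_ge0]; rewrite expf_eq0.
have n1 : 0 < enorm w + 1 by rewrite ltr_wpDl// enorm_ge0.
apply: (@le_of_le_addpowR _ _ _ (d%:R * s * enorm w `^ (1 + alpha))
  (Num.min r1 r2 / (enorm w + 1)) alpha a0).
  by rewrite divr_gt0// lt_min r10.
move=> t /andP[t0]; rewrite ltr_pdivlMr// lt_min => /andP[tr1 tr2].
have E : p + t *: w - p = t *: w by rewrite addrAC subrr add0r.
have w0 := enorm_ge0 w.
have tr' : t * enorm w < r1 by nra.
have := T (p + t *: w); rewrite E enormZ gtr0_norm// => /(_ tr').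
have /H : Om (p + t *: w) by apply: rO; rewrite E enormZ gtr0_norm//; nra.
rewrite E !dotpZr => Ht.
rewrite ler_norml powRM ?(ltW t0)// powR1D ?(ltW t0)// => /andP[_ T1].
rewrite add0r -(ler_pM2l t0).
have : t * dotp a w - t * dotp (grad g p) w = t * dotp w w.
  by rewrite -mulrBr -dotpBl.
nra.
Qed.

End Taylor.

(** * Estimates in the Hoelder classes *)

Section HolderClass.
Variables (R : realType) (d : nat) (Om : set 'rV[R]_d).
Hypotheses (oO : open Om) (scO : strictly_convex Om).
Implicit Types (x y p o v : 'rV[R]_d) (g : 'rV[R]_d -> R).

Lemma segmentE x y (t : R) : x + t *: (y - x) = t *: y + (1 - t) *: x.
Proof. by rewrite scalerBr scalerBl scale1r addrCA addrA addrC addrA. Qed.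

Lemma strictly_convex_convex : convex_closed Om.
Proof.
move=> x y t Ox Oy /andP[t0 t1].
have [->|xy] := eqVneq x y; first by rewrite -scalerDl addrC subrK scale1r.
move: t0; rewrite le_eqVlt => /orP[/eqP<-|t0].
  by rewrite scale0r subr0 scale1r add0r.
move: t1; rewrite le_eqVlt => /orP[/eqP->|t1].
  by rewrite subrr scale0r scale1r addr0.
by apply: scO => //; [exact: subset_closure|exact: subset_closure|rewrite t0].
Qed.

Lemma inner_point x o (t : R) : closure Om x -> Om o -> 0 < t < 1 ->
  Om (x + t *: (o - x)).
Proof.
move=> cx Oo t01; have [ox|ox] := eqVneq o x.
  by rewrite -ox subrr scaler0 addr0.
by rewrite segmentE; apply: scO => //; exact: subset_closure.
Qed.

Lemma near_inner_point x o : closure Om x -> Om o ->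
  \forall t \near (0 : R)^'+, Om (x + t *: (o - x)).
Proof.
move=> cx Oo; near=> t; apply: inner_point => //; apply/andP; split.
  by near: t; exact: nbhs_right_gt.
by near: t; apply: nbhs_right_lt.
Unshelve. all: by end_near. Qed.

Lemma near_inner_value g x o (e : R) :
  {within closure Om, continuous g} -> closure Om x -> Om o -> 0 < e ->
  \forall t \near (0 : R)^'+, `|g x - g (x + t *: (o - x))| < e.
Proof.
move=> /subspace_continuousP cg cx Oo e0.
have /nbhs_enormP[r r0 rP] : \forall y \near x, closure Om y -> `|g x - g y| < e.
  have /cvgrPdist_lt/(_ _ e0) := cg x cx; exact.
have n1 : 0 < enorm (o - x) + 1 by rewrite ltr_wpDl// enorm_ge0.
near=> t.
have t0 : 0 < t by near: t; exact: nbhs_right_gt.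
have t1 : t < 1 by near: t; exact: nbhs_right_lt.
have tr : t < r / (enorm (o - x) + 1).
  by near: t; apply: nbhs_right_lt; exact: divr_gt0.
apply: rP; last first.
  by apply: subset_closure; apply: inner_point => //; rewrite t0.
rewrite addrAC subrr add0r enormZ gtr0_norm//.
by move: tr; rewrite ltr_pdivlMr//; nra.
Unshelve. all: by end_near. Qed.

Variable alpha : R.
Hypothesis a0 : 0 < alpha.

Lemma holder_seminorm_ge0 k g : holder_class k alpha Om g ->
  0 <= holder_seminorm k alpha Om g.
Proof.
move=> [_ ub]; rewrite /holder_seminorm.
have [->|/set0P[q Qq]] := eqVneq (holder_quotients k alpha Om g) set0.
  by rewrite sup0.
apply: le_trans (ub_le_sup ub Qq).
by case: Qq => s [x [y [_ _ _ ->]]]; rewrite divr_ge0// powR_ge0.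
Qed.

Lemma holder_pderiv k g (s : k.-tuple 'I_d) x y : holder_class k alpha Om g ->
  Om x -> Om y ->
  `|pderiv s g x - pderiv s g y|
  <= holder_seminorm k alpha Om g * enorm (x - y) `^ alpha.
Proof.
move=> hg Ox Oy; have [->|xy] := eqVneq x y.
  by rewrite !subrr normr0 mulr_ge0 ?powR_ge0// holder_seminorm_ge0.
have e0 : 0 < enorm (x - y) by rewrite enorm_gt0 subr_eq0.
rewrite -ler_pdivrMr ?powR_gt0//; apply: ub_le_sup; first by case: hg.
by exists s, x, y; split.
Qed.

Lemma holder_taylor k g : k = 1%N -> holder_class k alpha Om g ->
  (forall x i, Om x -> derivable g x (delta_mx ord0 i)) /\
  (forall x y i, Om x -> Om y -> `|grad g x ord0 i - grad g y ord0 i|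
     <= holder_seminorm k alpha Om g * enorm (x - y) `^ alpha).
Proof.
move=> -> hg; split=> [x i Ox|x y i Ox Oy].
  by case: hg => -[_ H _] _; exact: (H [::]).
by have := @holder_pderiv 1 g [tuple i] x y hg Ox Oy; rewrite !mxE.
Qed.

(** Both points are pulled towards the same point of Om, which does not increase
    their distance. *)
Lemma holder0 k g x y : k = 0%N -> holder_class k alpha Om g ->
  closure Om x -> closure Om y ->
  `|g x - g y| <= holder_seminorm k alpha Om g * enorm (x - y) `^ alpha.
Proof.
move=> -> hg cx cy; have [z Oz _] := (closure_enormP Om x).1 cx 1 ltr01.
have cg : {within closure Om, continuous g} by case: hg => -[].
have s0 := holder_seminorm_ge0 hg.
apply/ler_addgt0Pr => e e0; have e2 : 0 < e / 2 by rewrite divr_gt0.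
near (0 : R)^'+ => t.
have t0 : 0 < t by near: t; exact: nbhs_right_gt.
have t1 : t < 1 by near: t; exact: nbhs_right_lt.
have Ox : Om (x + t *: (z - x)) by near: t; exact: near_inner_point.
have Oy : Om (y + t *: (z - y)) by near: t; exact: near_inner_point.
have gx : `|g x - g (x + t *: (z - x))| < e / 2 by near: t; exact: near_inner_value.
have gy : `|g y - g (y + t *: (z - y))| < e / 2 by near: t; exact: near_inner_value.
have H : `|g (x + t *: (z - x)) - g (y + t *: (z - y))|
    <= holder_seminorm 0 alpha Om g * enorm (x - y) `^ alpha.
  apply: le_trans (@holder_pderiv 0 g [tuple] _ _ hg Ox Oy) _.
  rewrite ler_wpM2l//; apply: ge0_ler_powR; rewrite ?nnegrE ?enorm_ge0 ?(ltW a0)//.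
  have -> : x + t *: (z - x) - (y + t *: (z - y)) = (1 - t) *: (x - y).
    by rewrite !segmentE opprD addrACA subrr add0r -scalerBr.
  rewrite enormZ ger0_norm ?subr_ge0 ?(ltW t1)//.
  by have := enorm_ge0 (x - y); nra.
move: gx gy H; rewrite !ltr_norml !ler_norml; lra.
Unshelve. all: by end_near. Qed.

Variable k : nat.
Hypothesis k01 : k = 0%N \/ k = 1%N.
Let D : R := d%:R.
Let beta : R := k%:R + alpha.

(** The tangent plane of g at p satisfies Jensen's inequality with equality, so that
    for k = 1 only the Taylor remainders at the points q i are left. *)
Lemma jensen_gap_inner g n (c : 'I_n -> R) (q : 'I_n -> 'rV[R]_d) p (r : R) :
  (0 < d)%N -> holder_class k alpha Om g -> weights c ->
  p = \sum_i c i *: q i -> (forall i, Om (q i)) ->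
  (forall i, 0 < c i -> enorm (q i - p) <= r) ->
  \sum_i c i * g (q i) <= g p + D * holder_seminorm k alpha Om g * r `^ beta.
Proof.
move=> d0 hg wc pE Oq qr; set s := holder_seminorm _ _ _ _.
have Op : Om p by rewrite pE; exact: convex_combination strictly_convex_convex _ _.
have s0 : 0 <= s := holder_seminorm_ge0 hg.
have D1 : 1 <= D by rewrite /D ler1n.
have mono i b : 0 <= b -> 0 < c i -> enorm (q i - p) `^ b <= r `^ b.
  move=> b0 ci; have := qr i ci => qir.
  apply: ge0_ler_powR; rewrite ?nnegrE ?enorm_ge0//.
  exact: le_trans (enorm_ge0 _) qir.
case: (k01) => kE.
  apply: weights_avg_le => // i ci; rewrite -lerBlDl.
  apply: le_trans (ler_norm _) _.
  apply: le_trans (holder0 kE hg (subset_closure (Oq i)) (subset_closure Op)) _.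
  rewrite -/s -mulrA; apply: (@le_trans _ _ (s * r `^ beta)).
    by rewrite ler_wpM2l// /beta kE add0r mono// ltW.
  by rewrite ler_peMl// mulr_ge0// powR_ge0.
have [dg hD] := holder_taylor kE hg.
pose l y := g p + dotp (grad g p) (y - p).
have al : affine_fun l.
  by exists (grad g p), (g p - dotp (grad g p) p) => y; rewrite /l dotpBr; ring.
have lp : \sum_i c i * l (q i) = g p.
  rewrite -(affine_sum _ al wc.2) -pE /l subrr -(scale0r 0) dotpZr mul0r addr0//.
rewrite -lp -lerBlDl -sumrB.
under eq_bigr do rewrite -mulrBr.
apply: weights_avg_le => // i ci.
apply: le_trans (ler_norm _) _; rewrite /l opprD addrA.
apply: le_trans (taylor oO strictly_convex_convex s0 a0 dg hD Op (Oq i)) _.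
rewrite /beta kE; apply: ler_wpM2l; first by rewrite mulr_ge0// /D ler0n.
by apply: mono => //; rewrite addr_ge0// ltW.
Qed.

(** The points are pulled towards an inner point of Om and back. *)
Lemma jensen_gap g n (c : 'I_n -> R) (q : 'I_n -> 'rV[R]_d) p (r : R) :
  (0 < d)%N -> holder_class k alpha Om g -> weights c ->
  p = \sum_i c i *: q i -> (forall i, closure Om (q i)) ->
  (forall i, 0 < c i -> enorm (q i - p) <= r) ->
  \sum_i c i * g (q i) <= g p + D * holder_seminorm k alpha Om g * r `^ beta.
Proof.
move=> d0 hg wc pE cq qr.
have cp : closure Om p.
  by rewrite pE; exact: convex_combination (strictly_convex_closure scO) _ _.
have [z Oz _] := (closure_enormP Om p).1 cp 1 ltr01.
have cg : {within closure Om, continuous g} by case: hg => -[].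
apply/ler_addgt0Pr => e e0; have e2 : 0 < e / 2 by rewrite divr_gt0.
near (0 : R)^'+ => t.
have t0 : 0 < t by near: t; exact: nbhs_right_gt.
have t1 : t < 1 by near: t; exact: nbhs_right_lt.
have Oq : forall i, Om (q i + t *: (z - q i)).
  by near: t; apply: filter_forall => i; exact: near_inner_point.
have gp : `|g p - g (p + t *: (z - p))| < e / 2 by near: t; exact: near_inner_value.
have gq : forall i, `|g (q i) - g (q i + t *: (z - q i))| < e / 2.
  by near: t; apply: filter_forall => i; exact: near_inner_value.
have pE' : p + t *: (z - p) = \sum_i c i *: (q i + t *: (z - q i)).
  rewrite segmentE -(weights_sum_const (t *: z) wc) pE scaler_sumr -big_split.
  apply: eq_bigr => i _ /=; rewrite segmentE scalerDr; congr (_ + _).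
  by rewrite !scalerA mulrC.
have qr' i : 0 < c i -> enorm (q i + t *: (z - q i) - (p + t *: (z - p))) <= r.
  move=> ci; have -> : q i + t *: (z - q i) - (p + t *: (z - p)) = (1 - t) *: (q i - p).
    by rewrite !segmentE opprD addrACA subrr add0r -scalerBr.
  rewrite enormZ ger0_norm ?subr_ge0 ?(ltW t1)//.
  by have := enorm_ge0 (q i - p); have := qr i ci; nra.
have H := jensen_gap_inner d0 hg wc pE' Oq qr'.
have : \sum_i c i * g (q i) <= \sum_i c i * g (q i + t *: (z - q i)) + e / 2.
  rewrite -lerBlDl -sumrB; under eq_bigr do rewrite -mulrBr.
  apply: weights_avg_le => // i _; apply: le_trans (ler_norm _) _; exact: ltW.
move: gp; rewrite ltr_norml; lra.
Unshelve. all: by end_near. Qed.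

Lemma second_difference_le g x v : (0 < d)%N -> holder_class k alpha Om g ->
  closure Om (x + v) -> closure Om (x - v) ->
  g (x + v) + g (x - v) - 2 * g x
  <= 2 * (D * holder_seminorm k alpha Om g * enorm v `^ beta).
Proof.
move=> d0 hg cp cm.
have wc : weights (fun _ : 'I_2 => 2^-1 : R).
  by split=> [i|]; rewrite ?invr_ge0// !big_ord_recl big_ord0 addr0; lra.
pose q (i : 'I_2) := if i == ord0 then x + v else x - v.
have := @jensen_gap g 2 (fun=> 2^-1) q x (enorm v) d0 hg wc.
rewrite !big_ord_recl !big_ord0 !addr0 /q /= => H.
suff : 2^-1 * g (x + v) + 2^-1 * g (x - v)
    <= g x + D * holder_seminorm k alpha Om g * enorm v `^ beta by lra.
apply: H => [|i|i _].
- by apply/rowP => i; rewrite !mxE; field.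
- by case: ifP.
- by case: ifP => _; rewrite addrAC subrr add0r ?enormN.
Qed.

End HolderClass.

Section HolderConvex.
Variables (R : realType) (d : nat) (Om : set 'rV[R]_d).
Hypotheses (oO : open Om) (scO : strictly_convex Om).
Variables (k : nat) (alpha : R).
Hypotheses (k01 : k = 0%N \/ k = 1%N) (a0 : 0 < alpha).
Implicit Types (x y p o v : 'rV[R]_d) (g : 'rV[R]_d -> R).
Let D : R := d%:R.
Let beta : R := k%:R + alpha.

(** By [touching_gradient] the touching plane is the tangent plane. *)
Lemma touching_le g p q (a : 'rV[R]_d) : k = 1%N -> holder_class k alpha Om g ->
  Om p -> Om q -> (forall z, Om z -> g p + dotp a (z - p) <= g z) ->
  g q <= g p + dotp a (q - p)
         + D * holder_seminorm k alpha Om g * enorm (q - p) `^ beta.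
Proof.
move=> kE hg Op Oq H; have [dg hD] := holder_taylor kE hg.
have s0 := holder_seminorm_ge0 hg.
have := taylor oO (strictly_convex_convex scO) s0 a0 dg hD Op Oq.
rewrite (touching_gradient oO s0 a0 dg hD Op H) ler_norml /beta kE /D; lra.
Qed.

Variable u : 'rV[R]_d -> R.
Hypothesis hu : holder_class k alpha Om u.
Hypothesis ju : forall n (c : 'I_n -> R) (p : 'I_n -> 'rV[R]_d), weights c ->
  (forall i, closure Om (p i)) -> u (\sum_i c i *: p i) <= \sum_i c i * u (p i).

Lemma convex_two_points x y (t : R) : closure Om x -> closure Om y -> 0 < t < 1 ->
  u (t *: y + (1 - t) *: x) <= t * u y + (1 - t) * u x.
Proof.
move=> cx cy /andP[t0 t1].
have := @ju 2 (fun i => if i == ord0 then t else 1 - t)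
  (fun i => if i == ord0 then y else x).
rewrite !big_ord_recl !big_ord0 !addr0 /=; apply.
  split=> [i|]; first by case: ifP => _; rewrite ?subr_ge0 ltW.
  by rewrite !big_ord_recl !big_ord0 /= addr0 addrC subrK.
by move=> i; case: ifP.
Qed.

Lemma convex_subgradient x y : k = 1%N -> Om x -> closure Om y ->
  u x + dotp (grad u x) (y - x) <= u y.
Proof.
move=> kE Ox cy; have [dg hD] := holder_taylor kE hu.
apply: (subgradient oO (holder_seminorm_ge0 hu) a0 dg hD Ox) => t t01.
rewrite segmentE; have := convex_two_points (subset_closure Ox) cy t01; lra.
Qed.

(** If u does not bend at x in the direction v, it touches its tangent plane at
    x along the segment, and leaves it slowly in the nearby directions. *)
Lemma flat_direction x v v' : (0 < d)%N -> Om x -> Om (x + v) -> Om (x - v) ->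
  Om (x + v') -> Om (x - v') -> u (x + v) + u (x - v) <= 2 * u x ->
  u (x + v') + u (x - v') - 2 * u x
  <= 2 * (D * holder_seminorm k alpha Om u * enorm (v - v') `^ beta).
Proof.
move=> d0 Ox Op Om' Oq Oq' flat; set s := holder_seminorm _ _ _ _.
have s0 : 0 <= s := holder_seminorm_ge0 hu.
have D1 : 1 <= D by rewrite /D ler1n.
have Ep : x + v' - (x + v) = v' - v by rewrite opprD addrACA subrr add0r.
have Em : x - v' - (x - v) = v - v'.
  by rewrite opprB addrC addrA subrK.
case: (k01) => kE.
  have := holder0 scO a0 kE hu (subset_closure Oq) (subset_closure Op).
  have := holder0 scO a0 kE hu (subset_closure Oq') (subset_closure Om').
  rewrite Ep Em (enormC v') -/s /beta kE add0r !ler_norml.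
  have : s * enorm (v - v') `^ alpha <= D * s * enorm (v - v') `^ alpha.
    by rewrite -mulrA ler_peMl// mulr_ge0// powR_ge0.
  lra.
pose a := grad u x.
have sub z : Om z -> u x + dotp a (z - x) <= u z.
  by move=> Oz; apply: convex_subgradient => //; exact: subset_closure.
have Exp : x + v - x = v by rewrite addrAC subrr add0r.
have Exm : x - v - x = - v by rewrite addrAC subrr add0r.
have := sub _ Op; have := sub _ Om'; rewrite Exp Exm dotpNr => Hm Hp.
have ep : u (x + v) = u x + dotp a v by lra.
have em : u (x - v) = u x - dotp a v by lra.
have tp z : Om z -> u (x + v) + dotp a (z - (x + v)) <= u z.
  by move=> /sub; rewrite ep !dotpBr dotpDr; lra.
have tm z : Om z -> u (x - v) + dotp a (z - (x - v)) <= u z.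
  by move=> /sub; rewrite em !dotpBr; lra.
have := touching_le kE hu Op Oq tp; have := touching_le kE hu Om' Oq' tm.
rewrite Ep Em (enormC v') -/s ep em !dotpBr; lra.
Qed.

(** The points y i carry the value of u at x, so y j is a contact point. For
    k = 1 the tangent plane of u at x even touches f from below at
    y j; for k = 0 the moduli of continuity of u and f are enough. *)
Lemma near_contact f n (c : 'I_n -> R) (y : 'I_n -> 'rV[R]_d) x j :
  (0 < d)%N -> holder_class k alpha Om f ->
  (forall z, closure Om z -> u z <= f z) ->
  Om x -> weights c -> (forall i, closure Om (y i)) -> x = \sum_i c i *: y i ->
  u x = \sum_i c i * f (y i) -> 0 < c j -> k = 0%N \/ Om (y j) ->
  f x <= u x + D * (holder_seminorm k alpha Om u + holder_seminorm k alpha Om f)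
           * enorm (x - y j) `^ beta.
Proof.
move=> d0 hf uf Ox wc cy xE uE cj kOy.
set s := holder_seminorm k alpha Om u; set sf := holder_seminorm k alpha Om f.
have s0 : 0 <= s := holder_seminorm_ge0 hu.
have sf0 : 0 <= sf := holder_seminorm_ge0 hf.
have D1 : 1 <= D by rewrite /D ler1n.
(* f - l is nonnegative with mean zero *)
have contact (l : 'rV[R]_d -> R) : (forall i, l (y i) <= f (y i)) ->
    u x <= \sum_i c i * l (y i) -> f (y j) = l (y j).
  move=> lf ul.
  have : \sum_i c i * (f (y i) - l (y i)) = 0.
    apply/eqP; rewrite eq_le sumr_ge0 ?andbT; last first.
      by move=> i _; rewrite mulr_ge0 ?subr_ge0// wc.1.
    by under eq_bigr do rewrite mulrBr; rewrite sumrB -uE subr_le0.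
  move=> /psumr_eq0P => /(_ _ j isT) H.
  have : c j * (f (y j) - l (y j)) = 0.
    by apply: H => i _; rewrite mulr_ge0 ?subr_ge0// wc.1.
  by move/eqP; rewrite mulf_eq0 (gt_eqF cj)/= subr_eq0 => /eqP.
have pw := powR_ge0 (enorm (x - y j)) beta.
case: (k01) => kE.
  have fj : f (y j) <= u x + s * enorm (x - y j) `^ alpha.
    have := holder0 scO a0 kE hu (subset_closure Ox) (cy j).
    rewrite -/s ler_norml.
    suff -> : f (y j) = u (y j) by lra.
    apply: contact => [i|]; first exact: uf.
    by rewrite xE; exact: ju.
  have := holder0 scO a0 kE hf (subset_closure Ox) (cy j).
  rewrite -/sf ler_norml => H; rewrite /beta kE add0r in pw *.
  have : (s + sf) * enorm (x - y j) `^ alpha <= D * (s + sf) * enorm (x - y j) `^ alpha.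
    by rewrite -mulrA ler_peMl// mulr_ge0// addr_ge0.
  lra.
have Oy : Om (y j) by case: kOy; rewrite ?kE.
pose l z := u x + dotp (grad u x) (z - x).
have al : affine_fun l.
  by exists (grad u x), (u x - dotp (grad u x) x) => z; rewrite /l dotpBr; ring.
have lu z : closure Om z -> l z <= u z by move=> cz; exact: convex_subgradient.
have fl : f (y j) = l (y j).
  apply: contact => [i|]; first exact: le_trans (lu _ (cy i)) (uf _ (cy i)).
  by rewrite -(affine_sum _ al wc.2) -xE /l subrr -(scale0r 0) dotpZr mul0r addr0.
have := touching_le (a := grad u x) kE hf Oy Ox.
have H z : Om z -> f (y j) + dotp (grad u x) (z - y j) <= f z.
  move=> /subset_closure cz; apply: le_trans (uf z cz).
  apply: le_trans (lu z cz); rewrite fl /l !dotpBr; lra.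
move=> /(_ H); rewrite fl /l -/sf.
have : 0 <= D * s * enorm (x - y j) `^ beta by rewrite !mulr_ge0// /D ler0n.
rewrite !dotpBr; lra.
Qed.

End HolderConvex.

(** * Supporting hyperplanes at nearest boundary points *)

Lemma closure_convex (R : realType) d (A : set 'rV[R]_d) :
  convex_closed A -> convex_closed (closure A).
Proof.
move=> cA x y t /closure_enormP cx /closure_enormP cy /[dup] t01 /andP[t0 t1].
apply/closure_enormP => r r0; have r2 : 0 < r / 2 by rewrite divr_gt0.
have [x' Ax' xx'] := cx _ r2; have [y' Ay' yy'] := cy _ r2.
exists (t *: x' + (1 - t) *: y'); first exact: cA.
rewrite opprD addrACA -!scalerBr; apply: le_lt_trans (enormD _ _) _.
rewrite !enormZ !ger0_norm ?subr_ge0//; nra.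
Qed.

Section ConvexDomain.
Variables (R : realType) (d : nat) (A : set 'rV[R]_d).
Hypotheses (d0 : (0 < d)%N) (oA : open A) (bA : bounded_set A).
Hypothesis cA : convex_closed A.
Implicit Types (x y z p q n : 'rV[R]_d).

Lemma boundary_neq0 x : A x -> boundary A !=set0.
Proof.
move=> Ax; have [rho rho0 rhoA] := bounded_closure_enorm bA.
pose z : 'rV[R]_d := const_mx (rho + 1).
have nAz : ~ A z.
  move=> /subset_closure /rhoA; apply/negP; rewrite -ltNge.
  have := enorm_coord z (Ordinal d0); rewrite mxE; apply: lt_le_trans.
  by rewrite gtr0_norm; lra.
have [t _ bt] := segment_meets_boundary oA Ax nAz.
by exists (x + t *: (z - x)).
Qed.

Lemma dist_boundary_le x y : boundary A y -> dist x (boundary A) <= enorm (x - y).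
Proof.
move=> By; apply: ge_inf; last by exists y.
by exists 0 => _ [z _ <-]; exact: enorm_ge0.
Qed.

Lemma nearest_boundary_point x : A x ->
  exists y, [/\ boundary A y, dist x (boundary A) = enorm (x - y)
              & 0 < enorm (x - y)].
Proof.
move=> Ax; have cont : {within boundary A, continuous (fun y => enorm (y - x))}.
  by apply: continuous_subspaceT; exact: enormB_continuous.
have [y] := compact_EVT_min (boundary_neq0 Ax) (compact_boundary bA) cont.
rewrite inE => By ymin; exists y; split => //.
  apply/eqP; rewrite eq_le dist_boundary_le//=.
  apply: lb_le_inf; first by exists (enorm (x - y)), y.
  by move=> _ [z Bz <-]; rewrite !(enormC x) ymin// inE.
rewrite enorm_gt0 subr_eq0; apply/eqP => xy.
by move: By; rewrite boundary_open// -xy => -[].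
Qed.

Lemma dist_boundary_gt0 x : A x -> 0 < dist x (boundary A).
Proof. by move=> /nearest_boundary_point[y [_ -> ]]. Qed.

Lemma lt_dist_boundary x z : A x -> enorm (z - x) < dist x (boundary A) -> A z.
Proof.
move=> Ax zx; apply: contrapT => nAz.
have [t /andP[t0 t1] /dist_boundary_le-/(_ x)] := segment_meets_boundary oA Ax nAz.
rewrite opprD addrA subrr sub0r enormN enormZ ger0_norm//.
by have := enorm_ge0 (z - x); nra.
Qed.

Lemma le_dist_boundary x z : A x -> enorm (z - x) <= dist x (boundary A) ->
  closure A z.
Proof.
move=> Ax zx; apply/closure_enormP => r r0.
have n0 := enorm_ge0 (z - x).
have n1 : 0 < enorm (z - x) + 1 by rewrite ltr_wpDl.
pose t := Num.min 1 (r / (2 * (enorm (z - x) + 1))).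
have t0 : 0 < t by rewrite lt_min ltr01 divr_gt0// mulr_gt0.
have t1 : t <= 1 by rewrite ge_min lexx.
have tr : t <= r / (2 * (enorm (z - x) + 1)) by rewrite ge_min lexx orbT.
move: tr; rewrite ler_pdivlMr ?mulr_gt0// => tr.
exists (z - t *: (z - x)).
  apply: (lt_dist_boundary Ax).
  have -> : z - t *: (z - x) - x = (1 - t) *: (z - x).
    by rewrite scalerBl scale1r addrAC.
  rewrite enormZ ger0_norm ?subr_ge0//.
  have := dist_boundary_gt0 Ax; nra.
rewrite addrAC subrr add0r enormN enormZ gtr0_norm//; nra.
Qed.

(** If some point of A were behind the hyperplane, y would be a convex combination
    of it and of a point of the open ball around x, hence a point of A. *)
Lemma nearest_point_supports x y q : A x ->
  dist x (boundary A) = enorm (x - y) -> boundary A y -> closure A q ->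
  0 <= dotp (x - y) (q - y).
Proof.
move=> Ax dE By cq.
suff H p : A p -> 0 <= dotp (x - y) (p - y).
  apply/ler_addgt0Pr => e e0.
  have n1 : 0 < enorm (x - y) + 1 by rewrite ltr_wpDl// enorm_ge0.
  have [p Ap pq] := (closure_enormP A q).1 cq (e / (enorm (x - y) + 1)) (divr_gt0 e0 n1).
  have := H p Ap; have -> : p - y = (q - y) + (p - q) by rewrite [RHS]addrC addrA subrK.
  rewrite dotpDr; have := dotp_le (x - y) (p - q).
  move: pq; rewrite ltr_pdivlMr//; have := enorm_ge0 (p - q); nra.
move=> Ap; rewrite leNgt; apply/negP => neg.
pose b := - dotp (x - y) (p - y).
have b0 : 0 < b by rewrite oppr_gt0.
pose N := dotp (p - y) (p - y).
have N0 : 0 <= N := dotp_ge0 _.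
pose k := b / (N + 1).
have k0 : 0 < k by rewrite divr_gt0// ltr_wpDl.
have kN : k * (N + 1) = b by rewrite /k divfK// gt_eqF// ltr_wpDl.
pose w := y - k *: (p - y).
have Aw : A w.
  apply: (lt_dist_boundary Ax); rewrite dE.
  rewrite -(@ltr_pXn2r _ 2)// ?nnegrE ?enorm_ge0// !sqr_enorm.
  have -> : w - x = - ((x - y) + k *: (p - y)).
    by rewrite /w opprD opprB addrAC.
  rewrite dotpNl dotpNr opprK dotp_sqrD !dotpZr !dotpZl.
  rewrite -/N; have -> : dotp (x - y) (p - y) = - b by rewrite /b opprK.
  nra.
have k1 : 0 < 1 + k by lra.
have : A y.
  have -> : y = (k / (1 + k)) *: p + (1 - k / (1 + k)) *: w.
    apply/rowP => i; rewrite !mxE; field; lra.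
  apply: cA => //; rewrite ler_pdivlMr// mul0r ler_pdivrMr// mul1r; lra.
by move: By; rewrite boundary_open// => -[].
Qed.

(** The unit slope makes m the distance to a hyperplane that has A on one side. *)
Definition supporting (m : 'rV[R]_d -> R) : Prop :=
  (exists2 n, enorm n = 1 & forall x z, m z = m x + dotp n (z - x)) /\
  forall x, closure A x -> 0 <= m x.

(** The ball around x that reaches the boundary is contained in the closure of A, on
    which m is nonnegative. *)
Lemma dist_le_supporting m x : supporting m -> A x -> dist x (boundary A) <= m x.
Proof.
move=> [[n n1 mE] m0] Ax; set r := dist x (boundary A).
have r0 : 0 < r := dist_boundary_gt0 Ax.
have : closure A (x - r *: n).
  apply: (le_dist_boundary Ax).
  by rewrite addrAC subrr add0r enormN enormZ n1 mulr1 gtr0_norm.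
move=> /m0; rewrite (mE x) addrAC subrr add0r dotpNr dotpZr -sqr_enorm n1.
by rewrite expr1n mulr1 subr_ge0.
Qed.

Lemma exists_supporting x : A x ->
  exists m n y, [/\ supporting m, enorm n = 1, forall z, m z = m x + dotp n (z - x),
    m x = dist x (boundary A) & [/\ boundary A y, m y = 0
    & enorm (x - y) = dist x (boundary A)]].
Proof.
move=> Ax; have [y [By dE e0]] := nearest_boundary_point Ax.
pose n := (enorm (x - y))^-1 *: (x - y).
have n1 : enorm n = 1.
  by rewrite enormZ ger0_norm ?invr_ge0 ?enorm_ge0// mulVf// gt_eqF.
pose m z := dotp n (z - y).
have mE x' z : m z = m x' + dotp n (z - x').
  by rewrite /m !dotpBr; ring.
have mx : m x = enorm (x - y).
  by rewrite /m dotpZl -sqr_enorm expr2 mulrA mulVf ?mul1r// gt_eqF.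
exists m, n, y; split => //; last 2 first.
- by rewrite dE.
- by split => //; rewrite /m subrr -(scale0r 0) dotpZr mul0r.
split; first by exists n.
move=> z cz; rewrite /m dotpZl mulr_ge0 ?invr_ge0 ?enorm_ge0//.
exact: nearest_point_supports dE By cz.
Qed.

End ConvexDomain.

(** * Barycentric coordinates *)

(* the predicate on simplices, not the one on bilinear forms *)
Local Notation nondegenerate := Defs.nondegenerate.

Section Simplex.
Variables (R : realType) (d : nat).
Implicit Types (P Q : 'M[R]_(d.+1, d)) (x y z : 'rV[R]_d).

Definition edges P : 'M[R]_d := \matrix_(i < d) (row (lift ord0 i) P - row ord0 P).

(** The barycentric coordinates of x with respect to the vertices of P: the
    coordinates of [x - row ord0 P] in the basis of the edges issuing from the
    vertex 0, and for this vertex the complement to 1. *)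
Definition bary P (i : 'I_d.+1) x : R :=
  let c := (x - row ord0 P) *m invmx (edges P) in
  if unlift ord0 i is Some j then c ord0 j else 1 - \sum_j c ord0 j.

Lemma nondegenerate_unit P : nondegenerate P -> edges P \in unitmx.
Proof. by rewrite /nondegenerate row_free_unit. Qed.

Lemma bary_affine P i : affine_fun (bary P i).
Proof.
pose a j : 'rV[R]_d := \row_l invmx (edges P) l j.
have E j x : ((x - row ord0 P) *m invmx (edges P)) ord0 j = dotp (a j) (x - row ord0 P).
  by rewrite mxE dotpC; apply: eq_bigr => l _; rewrite [a j _ _]mxE.
rewrite /bary; case: unliftP => [j|] _ /=.
  by exists (a j), (- dotp (a j) (row ord0 P)) => x; rewrite E dotpBr.
exists (- \sum_j a j), (1 + dotp (\sum_j a j) (row ord0 P)) => x.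
under eq_bigr do rewrite E dotpC.
rewrite -dotp_sumr dotpC dotpBr dotpNl; ring.
Qed.

Lemma bary_sum P x : \sum_i bary P i x = 1.
Proof.
rewrite big_ord_recl /bary unlift_none.
under [X in _ + X]eq_bigr do rewrite liftK.
by rewrite subrK.
Qed.

Lemma bary_combination P x : nondegenerate P -> \sum_i bary P i x *: row i P = x.
Proof.
move=> /nondegenerate_unit Pu.
pose c := (x - row ord0 P) *m invmx (edges P).
have xE : x - row ord0 P = \sum_j c ord0 j *: (row (lift ord0 j) P - row ord0 P).
  have : c *m edges P = x - row ord0 P by rewrite mulmxKV.
  by move=> <-; rewrite mulmx_sum_row; apply: eq_bigr => j _; rewrite rowK.
rewrite big_ord_recl /bary unlift_none -/c.
under [X in _ + X]eq_bigr do rewrite liftK.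
move: xE; rewrite (eq_bigr (fun j =>
  c ord0 j *: row (lift ord0 j) P - c ord0 j *: row ord0 P)); last first.
  by move=> j _; rewrite scalerBr.
rewrite sumrB -scaler_suml scalerBl scale1r.
move: (\sum_j c ord0 j) (\sum_j c ord0 j *: row (lift ord0 j) P) => t S xE.
by apply/rowP => i; move/rowP/(_ i): xE; rewrite !mxE; lra.
Qed.

Lemma bary_unique P (c : 'I_d.+1 -> R) x : nondegenerate P ->
  \sum_i c i = 1 -> x = \sum_i c i *: row i P -> forall i, bary P i x = c i.
Proof.
move=> /nondegenerate_unit Pu c1 xE.
have H : (x - row ord0 P) *m invmx (edges P) = \row_j c (lift ord0 j).
  apply: (canLR (mulmxK Pu)); rewrite mulmx_sum_row.
  rewrite xE big_ord_recl.
  have -> : c ord0 = 1 - \sum_(j < d) c (lift ord0 j).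
    by rewrite -c1 big_ord_recl addrK.
  under [RHS]eq_bigr do rewrite rowK mxE scalerBr.
  rewrite sumrB -scaler_suml scalerBl scale1r.
  by apply/rowP => i; rewrite !mxE; ring.
move=> i; rewrite /bary H; case: unliftP => [j ->|->]; first by rewrite mxE.
under eq_bigr do rewrite mxE.
by rewrite -c1 big_ord_recl addrK.
Qed.

Lemma faceP P (I : set 'I_d.+1) x : nondegenerate P ->
  face P I x <-> (forall i, 0 <= bary P i x) /\ (forall i, ~ I i -> bary P i x = 0).
Proof.
move=> Pn; split=> [[c [c0 cI c1 xE]]|[b0 bI]].
  have bE : forall i, bary P i x = c ord0 i.
    by apply: bary_unique => //; rewrite xE mulmx_sum_row.
  by split=> [i|i /cI]; rewrite bE.
exists (\row_i bary P i x); split.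
- by move=> i; rewrite mxE.
- by move=> i /bI; rewrite mxE.
- by under eq_bigr do rewrite mxE; exact: bary_sum.
- rewrite mulmx_sum_row -[LHS](bary_combination x Pn).
  by apply: eq_bigr => i _; rewrite mxE.
Qed.

Lemma simplexP P x : nondegenerate P -> simplex P x <-> forall i, 0 <= bary P i x.
Proof.
by move=> Pn; rewrite /simplex faceP//; split=> [[]//|b0]; split=> // i [].
Qed.

Lemma bary_weights P x : nondegenerate P -> simplex P x ->
  weights (fun i => bary P i x).
Proof. by move=> Pn /simplexP; split; [auto|exact: bary_sum]. Qed.

Lemma bary_vertex P i j : nondegenerate P -> bary P i (row j P) = (i == j)%:R.
Proof.
move=> Pn; apply: (@bary_unique _ (fun i => (i == j)%:R)) => //.
  rewrite (bigD1 j)//= eqxx big1 ?addr0// => l lj; by rewrite (negPf lj).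
rewrite (bigD1 j)//= eqxx scale1r big1 ?addr0// => l lj.
by rewrite (negPf lj) scale0r.
Qed.

Lemma vertex_simplex P i : nondegenerate P -> simplex P (row i P).
Proof. by move=> Pn; apply/simplexP => // j; rewrite bary_vertex. Qed.

Lemma simplex_combination P x y (t : R) : nondegenerate P -> simplex P x ->
  simplex P y -> 0 <= t <= 1 -> simplex P (t *: x + (1 - t) *: y).
Proof.
move=> Pn /simplexP-/(_ Pn) xP /simplexP-/(_ Pn) yP /andP[t0 t1].
apply/simplexP => // i; have [a [b E]] := bary_affine P i.
have := xP i; have := yP i; rewrite !E dotpDr !dotpZr => hy hx.
have : 0 <= t * (dotp a x + b) + (1 - t) * (dotp a y + b).
  by rewrite addr_ge0// mulr_ge0// subr_ge0.
lra.
Qed.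

Lemma closed_simplex P : nondegenerate P -> closed (simplex P).
Proof.
move=> Pn; have -> : simplex P = \bigcap_i (bary P i @^-1` [set t | 0 <= t]).
  apply/seteqP; split=> x; first by move=> /simplexP-/(_ Pn) H i _; exact: H.
  by move=> H; apply/simplexP => // i; exact: H.
apply: closed_bigI => i _; apply: preimage_closed; last exact: closed_ge.
by move=> x _; apply: affine_continuous; exact: bary_affine.
Qed.

Lemma simplex_enorm P x z (b : R) : nondegenerate P -> simplex P x ->
  (forall i, enorm (row i P - z) <= b) -> enorm (x - z) <= b.
Proof.
move=> Pn xP Pb; have wx := bary_weights Pn xP.
rewrite -[x](bary_combination x Pn) -[z in X in X <= _](weights_sum_const z wx) -sumrB.
apply: le_trans (enorm_sum _) _; under eq_bigr do rewrite -scalerBr enormZ.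
under eq_bigr => i _ do rewrite ger0_norm ?(wx.1 i)//.
exact: weights_avg_le.
Qed.

Lemma simplex_bounded P : nondegenerate P ->
  exists b, forall x, simplex P x -> enorm x <= b.
Proof.
move=> Pn; exists (\sum_i enorm (row i P)) => x xP; rewrite -[x]subr0.
apply: simplex_enorm xP _ => // i.
by rewrite subr0 (bigD1 i)//= lerDl sumr_ge0// => j _; exact: enorm_ge0.
Qed.

Lemma enorm_le_diam P x y : nondegenerate P -> simplex P x -> simplex P y ->
  enorm (x - y) <= diam (simplex P).
Proof.
move=> Pn xP yP; have [b bP] := simplex_bounded Pn.
apply: ub_le_sup; last by exists x => //; exists y.
exists (b + b) => _ [x' xP' [y' yP' <-]].
apply: le_trans (enormD _ _) _; rewrite enormN; apply: lerD; exact: bP.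
Qed.

Hypothesis d0 : (0 < d)%N.

Lemma diam_gt0 P : nondegenerate P -> 0 < diam (simplex P).
Proof.
move=> Pn; pose i1 : 'I_d.+1 := Ordinal (d0 : (1 < d.+1)%N).
apply: lt_le_trans (enorm_le_diam Pn (vertex_simplex ord0 Pn) (vertex_simplex i1 Pn)).
rewrite enorm_gt0 subr_eq0; apply/eqP => E.
have := bary_vertex ord0 i1 Pn; rewrite -E bary_vertex// eqxx => /eqP.
by rewrite eqr_nat.
Qed.

(** All barycentric coordinates are positive at the barycentre. *)
Lemma simplex_ball P : nondegenerate P ->
  exists c r, 0 < r /\ forall x, enorm (x - c) <= r -> simplex P x.
Proof.
move=> Pn; pose c := \sum_i (d.+1%:R)^-1 *: row i P.
have D0 : 0 < d.+1%:R :> R by rewrite ltr0n.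
have bc : forall i, bary P i c = (d.+1%:R)^-1.
  apply: bary_unique => //; rewrite sumr_const card_ord -[LHS]mulr_natl mulfV//.
have /choice[a aE] i : exists a, forall x, bary P i x = bary P i c + dotp a (x - c).
  have [a aE] := affineD (bary_affine P i); exists a => x; exact: aE.
pose S := 1 + \sum_i enorm (a i).
have S0 : 0 < S by rewrite ltr_wpDr// sumr_ge0// => i _; exact: enorm_ge0.
exists c, (d.+1%:R * S)^-1; split; first by rewrite invr_gt0 mulr_gt0.
move=> x xc; apply/simplexP => // i; rewrite aE bc.
have aS : enorm (a i) <= S.
  rewrite /S (bigD1 i)//= addrCA lerDl addr_ge0// sumr_ge0// => j _.
  exact: enorm_ge0.
have := dotp_le_enorm (a i) (x - c); rewrite ler_norml => /andP[H _].
have : enorm (a i) * enorm (x - c) <= S * (d.+1%:R * S)^-1.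
  by apply: ler_pM => //; exact: enorm_ge0.
have -> : S * (d.+1%:R * S)^-1 = d.+1%:R^-1.
  by rewrite invfM mulrCA mulfV ?mulr1// gt_eqF.
by move=> H2; rewrite -lerBlDl sub0r; apply: le_trans H; rewrite lerN2.
Qed.

(** On an inscribed ball a barycentric coordinate varies at most from 0 to 1, so
    that its slope is at most the inverse of the diameter of the ball. *)
Lemma inradius_bary P i x y : nondegenerate P ->
  0 < inradius_diam (simplex P) /\
  (bary P i x - bary P i y) * inradius_diam (simplex P) <= enorm (x - y).
Proof.
move=> Pn; have [a aE] := affineD (bary_affine P i).
have an0 : 0 < enorm a.
  rewrite enorm_gt0; apply/eqP => a0.
  have [j ji] : exists j, j != i.
    exists (lift i (Ordinal d0)); exact/eqP/nesym/eqP/neq_lift.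
  have := aE (row j P) (row i P); rewrite !bary_vertex// eqxx eq_sym (negPf ji).
  by rewrite a0 -(scale0r 0) dotpZl mul0r addr0 => /eqP; rewrite oner_eq0.
rewrite /inradius_diam; set S := [set 2 * r | r in _]; have ub r : S r -> r <= (enorm a)^-1.
  move=> [s [s0 [c cP]] <-].
  pose w := (s / enorm a) *: a.
  have wn : enorm w = s.
    by rewrite enormZ ger0_norm ?divr_ge0 ?enorm_ge0// divfK// gt_eqF.
  have aw : dotp a w = s * enorm a.
    rewrite dotpZr -sqr_enorm expr2 mulrA divfK// gt_eqF//.
  have p1 : simplex P (c + w) by apply: cP; rewrite addrAC subrr add0r wn.
  have p2 : simplex P (c - w) by apply: cP; rewrite addrAC subrr add0r enormN wn.
  have b1 : bary P i (c + w) <= 1.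
    rewrite -(bary_sum P (c + w)) (bigD1 i)//= lerDl sumr_ge0// => j _.
    by move/simplexP : p1; apply.
  have b2 : 0 <= bary P i (c - w) by move/simplexP : p2; apply.
  have := aE (c - w) (c + w).
  have -> : c + w - (c - w) = 2 *: w.
    by rewrite opprB addrC addrA subrK scaler_nat mulr2n.
  rewrite dotpZr aw => E.
  rewrite -[leRHS]mul1r ler_pdivlMr//; lra.
have [c [r [r0 rP]]] := simplex_ball Pn.
have S2r : S (2 * r).
  by exists r => //; split; [exact: ltW|exists c].
have hub : has_ubound S by exists (enorm a)^-1 => s; exact: ub.
have rho0 : 0 < sup S.
  by apply: lt_le_trans (ub_le_sup hub S2r); rewrite mulr_gt0.
split => //.
have rhoa : sup S <= (enorm a)^-1.
  by apply: ge_sup => //; exists (2 * r).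
rewrite (aE y x) addrAC subrr add0r.
have := dotp_le a (x - y) => H.
have [neg|pos] := leP (dotp a (x - y)) 0.
  by apply: le_trans (enorm_ge0 _); rewrite mulr_le0_ge0// ltW.
apply: (@le_trans _ _ (dotp a (x - y) * (enorm a)^-1)).
  by rewrite ler_wpM2l// ltW.
by rewrite ler_pdivrMr// mulrC.
Qed.

(** Contract an inscribed ball towards x. *)
Lemma simplex_closure_interior P x : nondegenerate P -> simplex P x ->
  closure (interior (simplex P)) x.
Proof.
move=> Pn xP; have [c [r [r0 rP]]] := simplex_ball Pn.
apply/closure_enormP => e e0.
have n1 : 0 < enorm (c - x) + 1 by rewrite ltr_wpDl// enorm_ge0.
pose t := Num.min 1 (e / (2 * (enorm (c - x) + 1))).
have t0 : 0 < t by rewrite lt_min ltr01 divr_gt0// mulr_gt0.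
have t1 : t <= 1 by rewrite ge_min lexx.
have te : t <= e / (2 * (enorm (c - x) + 1)) by rewrite ge_min lexx orbT.
move: te; rewrite ler_pdivlMr ?mulr_gt0// => te.
exists (x + t *: (c - x)); last first.
  rewrite addrAC subrr add0r enormZ gtr0_norm//.
  by have := enorm_ge0 (c - x); nra.
apply/nbhs_enormP; exists (t * r); first exact: mulr_gt0.
move=> y yx; pose z := c + t^-1 *: (y - (x + t *: (c - x))).
have -> : y = t *: z + (1 - t) *: x.
  by apply/rowP => i; rewrite !mxE; field; lra.
apply: simplex_combination => //; last by rewrite ltW.
apply: rP; rewrite /z addrAC subrr add0r enormZ gtr0_norm ?invr_gt0//.
by rewrite mulrC ler_pdivrMr// mulrC ltW.
Qed.

End Simplex.

(** * Geometry of the mesh *)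

Section MeshGeometry.
Variables (R : realType) (d : nat) (Om : set 'rV[R]_d) (sigma : R).
Variable Th : seq 'M[R]_(d.+1, d).
Hypotheses (d0 : (0 < d)%N) (bO : bounded_set Om).
Hypothesis adm : admissible_mesh Om sigma Th.
Implicit Types (P Q : 'M[R]_(d.+1, d)) (x y z : 'rV[R]_d).
Let G := mesh_domain Th.
Let h := mesh_size Th.

Lemma mesh_nondegenerate P : P \in Th -> nondegenerate P.
Proof. by case: adm => -[H _] _ _ _ _; exact: H. Qed.

Lemma mesh_domain_open : open G.
Proof. exact: open_interior. Qed.

Lemma mesh_domain_sub : G `<=` Om.
Proof. by case: adm. Qed.

Lemma mesh_domain_bounded : bounded_set G.
Proof.
case: bO => M [Mr MO]; exists M; split => // t Mt x Gx; apply: (MO t Mt).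
exact: mesh_domain_sub.
Qed.

Lemma mesh_domain_convex : convex_closed G.
Proof.
case: adm => _ _ _ _ cG x y t Gx Gy /andP[t0 t1].
by have := cG x y (Itv01 t0 t1); rewrite !inE => /(_ Gx Gy).
Qed.

Lemma mesh_union_closed : closed (mesh_union Th).
Proof.
have : forall s : seq 'M[R]_(d.+1, d), {in s, forall P, nondegenerate P} ->
    closed (mesh_union s).
  elim=> [_|P s IH Hs].
    have -> : @mesh_union R d [::] = set0.
      by apply/seteqP; split=> // x [P]; rewrite in_nil.
    exact: closed0.
  have -> : mesh_union (P :: s) = simplex P `|` mesh_union s.
    apply/seteqP; split=> x.
      move=> [Q]; rewrite inE => /predU1P[->|Qs] Qx; first by left.
      by right; exists Q.
    move=> [Px|[Q Qs Qx]]; first by exists P; rewrite // inE eqxx.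
    by exists Q; rewrite // inE Qs orbT.
  apply: closedU.
    by apply: closed_simplex; apply: Hs; rewrite inE eqxx.
  by apply: IH => Q Qs; apply: Hs; rewrite inE Qs orbT.
by apply => P; exact: mesh_nondegenerate.
Qed.

Lemma mesh_domain_cell x : closure G x -> exists2 P, P \in Th & simplex P x.
Proof.
move=> cx; have : mesh_union Th x; last by [].
apply: mesh_union_closed; apply: closure_subset cx; exact: interior_subset.
Qed.

Lemma cell_closure P x : P \in Th -> simplex P x -> closure G x.
Proof.
move=> PT Px.
refine (closure_subset _ (simplex_closure_interior (mesh_nondegenerate PT) Px)).
by apply: interiorS => y Py; exists P.
Qed.

Lemma node_closure x : node Th x -> closure G x.
Proof.
move=> [P PT [i ->]]; apply: (cell_closure PT).
exact/vertex_simplex/mesh_nondegenerate.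
Qed.

Lemma cell_node P i : P \in Th -> node Th (row i P).
Proof. by move=> PT; exists P => //; exists i. Qed.

(** A node lies in the closure of the domain, and on its boundary only if it is a
    boundary node. *)
Lemma inode_domain x : inode Om Th x -> G x.
Proof.
move=> [nx nb]; apply: contrapT => nGx; apply: nb; split => //.
case: adm => _ _ + _ _; apply; split => //.
rewrite boundary_open; last exact: mesh_domain_open.
by split => //; exact: node_closure.
Qed.

Lemma diam_le_mesh_size P : P \in Th -> diam (simplex P) <= h.
Proof.
rewrite /h /mesh_size; elim: Th => // Q s IH; rewrite inE big_cons le_max.
by move=> /predU1P[->|/IH->]; rewrite ?lexx ?orbT.
Qed.

Lemma vertex_dist_le P i x : P \in Th -> simplex P x -> enorm (row i P - x) <= h.
Proof.
move=> PT Px; have Pn := mesh_nondegenerate PT.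
exact: le_trans (enorm_le_diam Pn (vertex_simplex i Pn) Px) (diam_le_mesh_size PT).
Qed.

Lemma mesh_size_gt0 P : P \in Th -> 0 < h.
Proof.
move=> PT; apply: lt_le_trans (diam_le_mesh_size PT).
exact: diam_gt0 (mesh_nondegenerate PT).
Qed.

Lemma sigma_inradius P : P \in Th ->
  0 < sigma /\ h <= sigma ^+ 2 * inradius_diam (simplex P).
Proof.
move=> PT; have Pn := mesh_nondegenerate PT.
have [rho0 _] := inradius_bary d0 ord0 0 0 Pn.
have D0 := diam_gt0 d0 Pn.
case: adm => _ [/(_ P PT) + /(_ P PT)[hs _]] _ _ _.
rewrite ler_pdivrMr// => sr.
have s0 : 0 < sigma.
  by rewrite -(pmulr_lgt0 _ rho0); apply: lt_le_trans sr.
split=> //; apply: le_trans hs _.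
by rewrite expr2 -mulrA ler_pM2l.
Qed.

(** The segment from an interior node x to a nearest boundary point y starts in
    some cell having x as a vertex. At y the barycentric coordinate of x in this
    cell is at most 0: otherwise y would lie in the cell, with a positive weight
    on x, while all vertices lie on one side of the hyperplane supporting the
    domain at y and x does not lie on it. So this coordinate drops by at least 1
    from x to y, and [inradius_bary] bounds its slope. *)
Lemma inode_dist x : inode Om Th x ->
  0 < sigma /\ h <= sigma ^+ 2 * dist x (boundary G).
Proof.
move=> ix; have Gx := inode_domain ix.
have [m [n [y [[_ m0] n1 mE mx [By my xy]]]]] :=
  exists_supporting d0 mesh_domain_open mesh_domain_bounded mesh_domain_convex Gx.
have dpos : 0 < dist x (boundary G).
  exact: dist_boundary_gt0 d0 mesh_domain_open mesh_domain_bounded _ Gx.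
have cy : closure G y by case: By.
have [Q QT [t [t0 t1] [Qx Qt]]] : exists2 Q, Q \in Th &
    exists2 t, 0 < t /\ t <= 1 & simplex Q x /\ simplex Q (x + t *: (y - x)).
  have far : \forall t \near (0 : R)^'+, forall Q, Q \in Th -> ~ simplex Q x ->
      ~ simplex Q (x + t *: (y - x)).
    have : forall s : seq 'M[R]_(d.+1, d), {subset s <= Th} ->
      \forall t \near (0 : R)^'+, forall Q, Q \in s -> ~ simplex Q x ->
        ~ simplex Q (x + t *: (y - x)).
      elim=> [_|Q s IH sT]; first by near=> t => Q; rewrite in_nil.
      have QT : Q \in Th by apply: sT; rewrite inE eqxx.
      have IHs := IH (fun P Ps => sT P (mem_behead (s := Q :: s) Ps)).
      have H : \forall t \near (0 : R)^'+, ~ simplex Q x ->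
          ~ simplex Q (x + t *: (y - x)).
        have [Qx|nQx] := pselect (simplex Q x); first by near=> t.
        have oQ : open (~` simplex Q).
          by apply: closed_openC; exact: closed_simplex (mesh_nondegenerate QT).
        have [r r0 rQ] := open_enorm oQ nQx.
        have e1 : 0 < enorm (y - x) + 1 by rewrite ltr_wpDl// enorm_ge0.
        near=> t => _; apply: rQ; rewrite addrAC subrr add0r enormZ.
        have t0 : 0 < t by near: t; exact: nbhs_right_gt.
        have : t < r / (enorm (y - x) + 1).
          by near: t; apply: nbhs_right_lt; exact: divr_gt0.
        rewrite gtr0_norm// ltr_pdivlMr//; nra.
      near=> t => P; rewrite inE => /predU1P[->|Ps].
        by near: t.
      by move: P Ps; near: t.
    by apply.
  near (0 : R)^'+ => t.
  have t0 : 0 < t by near: t; exact: nbhs_right_gt.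
  have t1 : t <= 1 by near: t; apply: nbhs_right_ltW.
  have cxt : closure G (x + t *: (y - x)).
    have cc := closure_convex mesh_domain_convex.
    have -> : x + t *: (y - x) = t *: y + (1 - t) *: x.
      by rewrite scalerBr scalerBl scale1r addrCA addrA addrC addrA.
    by apply: cc => //; [exact: subset_closure|rewrite ltW].
  have [Q QT Qt] := mesh_domain_cell cxt.
  exists Q => //; exists t => //; split => //.
  apply: contrapT => nQx; have : ~ simplex Q (x + t *: (y - x)).
    by move: Q QT nQx {Qt}; near: t.
  exact.
have Qn := mesh_nondegenerate QT.
have [i xE] : exists i, x = row i Q.
  case: ix => -[P PT [j xj]] _.
  have Pn := mesh_nondegenerate PT.
  have : (simplex P `&` simplex Q) x.
    by split => //; rewrite xj; exact: vertex_simplex.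
  case: adm => -[_ /(_ P Q PT QT)->] _ _ _ _.
  move=> /(faceP _ _ Pn)[_] /(_ j) H.
  apply: contrapT => nv; have /H : ~ vertex Q (row j P).
    by move=> [l El]; apply: nv; exists l; rewrite xj.
  by rewrite xj bary_vertex// eqxx => /eqP; rewrite oner_eq0.
have [rho0 rhoy] := inradius_bary d0 i x y Qn.
have [s0 hs] := sigma_inradius QT; split=> //.
apply: le_trans hs _; rewrite ler_pM2l ?exprn_gt0// -xy.
apply: le_trans rhoy; rewrite ler_peMl ?(ltW rho0)//.
rewrite {1}xE bary_vertex// eqxx /= lerBrDr gerDl leNgt; apply/negP => bpos.
have bnn j : 0 <= bary Q j y.
  have [->|ji] := eqVneq j i; first exact: ltW.
  have [a [b aE]] := bary_affine Q j.
  have bx : bary Q j x = 0 by rewrite xE bary_vertex// (negPf ji).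
  have : 0 <= bary Q j (x + t *: (y - x)) by move/simplexP : Qt; exact.
  have -> : bary Q j (x + t *: (y - x)) = t * bary Q j y + (1 - t) * bary Q j x.
    by rewrite !aE !dotpE; ring.
  by rewrite bx mulr0 addr0 pmulr_rge0.
have am : affine_fun m.
  exists n, (m x - dotp n x) => z; rewrite (mE z) dotpBr; ring.
have : 0 < \sum_j bary Q j y * m (row j Q).
  rewrite (bigD1 i)//= ltr_pwDl//.
    by rewrite mulr_gt0// -xE mx.
  apply: sumr_ge0 => j _; rewrite mulr_ge0// m0//.
  exact: node_closure (cell_node _ QT).
by rewrite -(affine_sum _ am (bary_sum Q y)) bary_combination// my ltxx.
Unshelve. all: by end_near. Qed.

(** A supporting hyperplane through a boundary point contains the vertices of the
    face in which the point lies. *)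
Lemma near_bnode m y : supporting G m -> closure G y -> m y = 0 ->
  exists2 z, bnode Om Th z & enorm (z - y) <= h.
Proof.
move=> [[n n1 mE] m0] cy my.
have [P PT Py] := mesh_domain_cell cy.
have Pn := mesh_nondegenerate PT.
have [i bi] : exists i, 0 < bary P i y.
  apply: contrapT => nex; have := bary_sum P y; rewrite big1 => [/eqP|i _].
    by rewrite eq_sym oner_eq0.
  apply/eqP; rewrite eq_le; apply/andP; split; last by move/simplexP : Py; exact.
  by rewrite leNgt; apply/negP => H; apply: nex; exists i.
have am : affine_fun m.
  exists n, (m y - dotp n y) => z; rewrite (mE y) dotpBr; ring.
have pos j : 0 <= m (row j P) by apply: m0; exact: node_closure (cell_node _ PT).
have mi : m (row i P) = 0.
  have : \sum_j bary P j y * m (row j P) = 0.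
    by rewrite -(affine_sum _ am (bary_sum P y)) bary_combination.
  move=> /psumr_eq0P => /(_ _ i isT) H.
  have /eqP : bary P i y * m (row i P) = 0.
    by apply: H => j _; rewrite mulr_ge0//; move/simplexP : Py; exact.
  by rewrite mulf_eq0 gt_eqF//= => /eqP.
exists (row i P); last exact: vertex_dist_le.
have ni := cell_node i PT.
split => //; case: adm => _ _ + _ _; apply; split => //.
rewrite boundary_open; last exact: mesh_domain_open.
split; first exact: node_closure.
move=> Gi; have [r r0 rG] := open_enorm mesh_domain_open Gi.
have : 0 <= m (row i P - (r / 2) *: n).
  apply: m0; apply: subset_closure; apply: rG.
  by rewrite addrAC subrr add0r enormN enormZ n1 mulr1 gtr0_norm; lra.
rewrite (mE (row i P)) mi (addrC (row i P)) addrK dotpNr dotpZr -sqr_enorm n1; lra.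
Qed.

End MeshGeometry.

(** * A concave barrier for the boundary layer *)

Section Sqrt.
Variable R : realType.

Lemma sqrt_concave n (c t : 'I_n -> R) : weights c -> (forall i, 0 <= t i) ->
  \sum_i c i * Num.sqrt (t i) <= Num.sqrt (\sum_i c i * t i).
Proof.
move=> wc t0; set T := \sum_i c i * t i.
have T0 : 0 <= T by apply: sumr_ge0 => i _; rewrite mulr_ge0// wc.1.
have [TE|Tn] := eqVneq T 0.
  rewrite TE sqrtr0 big1// => i _.
  have /eqP : c i * t i = 0.
    by move: TE => /psumr_eq0P; apply => // j _; rewrite mulr_ge0// wc.1.
  by rewrite mulf_eq0 => /orP[/eqP->|/eqP->]; rewrite ?sqrtr0 ?mul0r ?mulr0.
have e0 : 0 < Num.sqrt T by rewrite sqrtr_gt0 lt_neqAle eq_sym Tn.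
(* the tangent of the square root at T *)
have tangent i : Num.sqrt (t i) <= (t i + T) / (2 * Num.sqrt T).
  rewrite ler_pdivlMr ?mulr_gt0// -[t i in leRHS]sqr_sqrtr// -[T in leRHS]sqr_sqrtr//.
  by have := sqr_ge0 (Num.sqrt (t i) - Num.sqrt T); nra.
apply: (@le_trans _ _ (\sum_i c i * ((t i + T) / (2 * Num.sqrt T)))).
  by apply: weights_le.
under eq_bigr do rewrite mulrA mulrDr.
rewrite -mulr_suml big_split/= -mulr_suml wc.2 mul1r -/T.
rewrite ler_pdivrMr ?mulr_gt0// mulrCA -expr2 sqr_sqrtr//; lra.
Qed.

(** Squaring the sum leaves the product of the two square roots, which is squared in
    turn. *)
Lemma sqrt_second_difference (s tau kappa : R) : 0 < s -> 0 <= kappa <= 1 ->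
  kappa * s <= tau -> tau <= s ->
  Num.sqrt (s + tau) + Num.sqrt (s - tau) - 2 * Num.sqrt s
  <= - (kappa ^+ 2 / 4) * Num.sqrt s.
Proof.
move=> s0 /andP[k0 k1] kt ts.
have t0 : 0 <= tau by apply: le_trans kt; rewrite mulr_ge0// ltW.
set a := Num.sqrt (s + tau); set b := Num.sqrt (s - tau); set e := Num.sqrt s.
have a0 : 0 <= a := sqrtr_ge0 _; have b0 : 0 <= b := sqrtr_ge0 _.
have e0 : 0 < e by rewrite sqrtr_gt0.
have a2 : a ^+ 2 = s + tau by rewrite sqr_sqrtr//; lra.
have b2 : b ^+ 2 = s - tau by rewrite sqr_sqrtr//; lra.
have e2 : e ^+ 2 = s by rewrite sqr_sqrtr// ltW.
have kk : kappa ^+ 2 <= 1 by rewrite expr_le1.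
have ab : a * b <= s * (1 - kappa ^+ 2 / 2).
  rewrite -(@ler_pXn2r _ 2)// ?nnegrE ?mulr_ge0//; [|exact: ltW|lra].
  rewrite !exprMn a2 b2.
  have : (kappa * s) ^+ 2 <= tau ^+ 2.
    by rewrite ler_pXn2r ?nnegrE// mulr_ge0// ltW.
  have : 0 <= s ^+ 2 * kappa ^+ 4 by rewrite mulr_ge0// exprn_ge0// ltW.
  rewrite exprMn.
  have -> : s ^+ 2 * (1 - kappa ^+ 2 / 2) ^+ 2 =
    s ^+ 2 - s ^+ 2 * kappa ^+ 2 + s ^+ 2 * kappa ^+ 4 / 4 by field.
  have -> : (s + tau) * (s - tau) = s ^+ 2 - tau ^+ 2 by ring.
  lra.
suff : a + b <= (2 - kappa ^+ 2 / 4) * e by lra.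
rewrite -(@ler_pXn2r _ 2)// ?nnegrE ?addr_ge0 ?mulr_ge0 ?(ltW e0)//; last lra.
rewrite exprMn e2 sqrrD a2 b2.
have -> : (2 - kappa ^+ 2 / 4) ^+ 2 * s = s * 4 - s * kappa ^+ 2 + s * (kappa ^+ 4 / 16).
  by field.
have : 0 <= s * (kappa ^+ 4 / 16) by rewrite mulr_ge0 ?divr_ge0 ?exprn_ge0// ltW.
rewrite mulr2n; lra.
Qed.

End Sqrt.

Section Barrier.
Variables (R : realType) (d : nat) (A : set 'rV[R]_d).
Hypotheses (d0 : (0 < d)%N) (oA : open A) (bA : bounded_set A).
Hypothesis cA : convex_closed A.
Implicit Types (x y z p q n : 'rV[R]_d).

(** Close to the boundary of A this is the square root of the distance to it.
    Taking the infimum over the supporting hyperplanes makes concavity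
    immediate. *)
Definition barrier (L : R) z : R :=
  inf [set Num.min (Num.sqrt (m z)) (Num.sqrt L) | m in supporting A].

Lemma barrier_le L m z : supporting A m ->
  barrier L z <= Num.min (Num.sqrt (m z)) (Num.sqrt L).
Proof.
move=> sm; apply: ge_inf; last by exists m.
by exists 0 => _ [m' _ <-]; rewrite le_min !sqrtr_ge0.
Qed.

Lemma barrier_ge0 L z : 0 <= barrier L z.
Proof.
rewrite /barrier; set S := [set _ | _ in _].
have [->|S0] := eqVneq S set0; first by rewrite inf0.
apply: lb_le_inf; first exact/set0P.
by move=> _ [m _ <-]; rewrite le_min !sqrtr_ge0.
Qed.

Lemma barrier_bounded L z : barrier L z <= Num.sqrt L.
Proof.
have [[m sm]|nex] := pselect (exists m, supporting A m).
  by apply: le_trans (barrier_le L z sm) _; rewrite ge_min lexx orbT.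
rewrite /barrier; have -> : supporting A = set0.
  by apply/seteqP; split=> // m sm; apply: nex; exists m.
by rewrite image_set0 inf0 sqrtr_ge0.
Qed.

Lemma barrier_jensen L (n : nat) (c : 'I_n -> R) (q : 'I_n -> 'rV[R]_d) z0 : A z0 ->
  weights c -> (forall i, closure A (q i)) ->
  \sum_i c i * barrier L (q i) <= barrier L (\sum_i c i *: q i).
Proof.
move=> Az0 wc cq.
have [m0 [_ [_ [sm0 _ _ _ _]]]] := exists_supporting d0 oA bA cA Az0.
apply: lb_le_inf; first by exists (Num.min (Num.sqrt (m0 (\sum_i c i *: q i))) (Num.sqrt L)), m0.
move=> _ [m sm <-]; rewrite le_min; apply/andP; split; last first.
  by apply: weights_avg_le => // i _; exact: barrier_bounded.
have am : affine_fun m.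
  case: sm => -[a _ mE] _; exists a, (m 0) => z; rewrite (mE 0 z) subr0; ring.
rewrite (affine_sum _ am wc.2); apply: le_trans (sqrt_concave wc _); last first.
  by move=> i; case: sm => _; apply; exact: cq.
apply: weights_le => // i _; apply: le_trans (barrier_le L (q i) sm) _.
by rewrite ge_min lexx.
Qed.

Lemma barrier_concave2 L x v : A x -> closure A (x + v) -> closure A (x - v) ->
  barrier L (x + v) + barrier L (x - v) <= 2 * barrier L x.
Proof.
move=> Ax cp cm.
have wc : weights (fun _ : 'I_2 => 2^-1 : R).
  by split=> [i|]; rewrite ?invr_ge0// !big_ord_recl big_ord0 addr0; lra.
have := @barrier_jensen L 2 (fun=> 2^-1) (fun i => if i == ord0 then x + v else x - v) x Ax wc.
rewrite !big_ord_recl !big_ord0 !addr0 /= => /(_ _)H.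
have xE : 2^-1 *: (x + v) + 2^-1 *: (x - v) = x.
  by apply/rowP => i; rewrite !mxE; field.
suff : 2^-1 * barrier L (x + v) + 2^-1 * barrier L (x - v) <= barrier L x by lra.
by rewrite xE in H; apply: H => i; case: ifP.
Qed.

(** In a direction close to the normal n at the nearest boundary point the distance
    to the supporting hyperplane changes by at least half of the step, and the
    square root of this distance bends accordingly. The net contains such a
    direction as soon as theta is at most 1. *)
Lemma barrier_layer M delta theta (S : seq 'rV[R]_d) x : 1 <= M -> 0 < delta ->
  theta <= 1 -> direction_net theta S -> A x ->
  dist x (boundary A) <= M * delta ->
  exists2 v, v \in S &
    let di := Num.min delta (dist x (boundary A)) in
    barrier (M * delta) (x + di *: v) + barrier (M * delta) (x - di *: v)
    - 2 * barrier (M * delta) x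
    <= - (16 * M ^+ 2)^-1 * Num.sqrt (dist x (boundary A)).
Proof.
move=> M1 de0 th1 [Sn Snet] Ax; set s := dist x (boundary A) => sM.
have s0 : 0 < s := dist_boundary_gt0 d0 oA bA Ax.
have [m [n [_ [sm n1 mE mx _]]]] := exists_supporting d0 oA bA cA Ax.
have [v vS nv] := Snet n n1; exists v => //=; set di := Num.min _ _.
have v1 := Sn v vS.
have nv2 : 2^-1 <= dotp n v.
  have : enorm (n - v) ^+ 2 <= 1.
    by rewrite expr_le1// ?enorm_ge0//; exact: le_trans nv th1.
  rewrite sqr_enorm dotp_sqrB -!sqr_enorm n1 v1 expr1n; lra.
have nv1 : dotp n v <= 1.
  by apply: le_trans (dotp_le n v) _; rewrite n1 v1 mulr1.
have M0 : 0 < M by exact: lt_le_trans M1.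
have dis : di <= s by rewrite ge_min lexx orbT.
have Mdi : s <= M * di.
  have [ds|sd] := leP delta s; first by rewrite /di min_l.
  by rewrite /di min_r ?(ltW sd)// ler_peMl// ltW.
have di0 : 0 < di by rewrite lt_min de0.
have up z : barrier (M * delta) z <= Num.sqrt (m z).
  by apply: le_trans (barrier_le _ z sm) _; rewrite ge_min lexx.
have low : Num.sqrt s <= barrier (M * delta) x.
  apply: lb_le_inf; first by exists (Num.min (Num.sqrt (m x)) (Num.sqrt (M * delta))), m.
  move=> _ [m' sm' <-]; rewrite le_min !ler_sqrt ?mulr_ge0 ?(ltW M0) ?(ltW de0)//.
    by rewrite sM andbT; exact: dist_le_supporting sm' Ax.
  by case: sm' => _; apply; exact: subset_closure.
have xp : x + di *: v - x = di *: v by rewrite addrAC subrr add0r.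
have xm : x - di *: v - x = - (di *: v) by rewrite addrAC subrr add0r.
have := up (x + di *: v); have := up (x - di *: v).
rewrite (mE (x + di *: v)) (mE (x - di *: v)) xp xm dotpNr dotpZr mx -/s => um up'.
have ktau : (2 * M)^-1 * s <= di * dotp n v.
  have : di * 2^-1 <= di * dotp n v by rewrite ler_pM2l.
  apply: le_trans; rewrite ler_pdivrMl ?mulr_gt0//; lra.
have taus : di * dotp n v <= s by apply: le_trans dis; rewrite ger_pMr.
have k01 : 0 <= (2 * M)^-1 <= 1.
  by rewrite invr_ge0 mulr_ge0 ?(ltW M0)//= invf_le1 ?mulr_gt0//; lra.
have := sqrt_second_difference s0 k01 ktau taus.
have -> : (2 * M)^-1 ^+ 2 / 4 = (16 * M ^+ 2)^-1 by field; lra.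
lra.
Qed.

End Barrier.

(** * Finite extrema and flat segments *)

Section Generic.
Variable R : realType.

Lemma seq_argmax (T : eqType) (s : seq T) (g : T -> R) : s != [::] ->
  exists2 x, x \in s & forall y, y \in s -> g y <= g x.
Proof.
elim: s => // a s IH _; have [->|s0] := eqVneq s [::].
  by exists a; rewrite ?inE// => y; rewrite inE => /eqP->.
have [x xs xmax] := IH s0; have [ax|xa] := leP (g a) (g x).
  exists x; first by rewrite inE xs orbT.
  by move=> y; rewrite inE => /predU1P[->|/xmax].
exists a; first by rewrite inE eqxx.
move=> y; rewrite inE => /predU1P[->//|/xmax] yx; exact: le_trans yx (ltW xa).
Qed.

Lemma bigmin_seq_le (T : eqType) (s : seq T) (g : T -> R) (a : R) :
  \big[Num.min/a]_(v <- s) g v <= a /\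
  forall v, v \in s -> \big[Num.min/a]_(v <- s) g v <= g v.
Proof.
elim: s => [|w s [IHa IH]]; first by rewrite big_nil lexx; split.
rewrite big_cons; split=> [|v]; first by rewrite ge_min IHa orbT.
by rewrite inE ge_min => /predU1P[->|/IH->]; rewrite ?lexx ?orbT.
Qed.

Lemma bigmin_seq_attained (T : eqType) (s : seq T) (g : T -> R) (a : R) :
  \big[Num.min/a]_(v <- s) g v = a \/
  exists2 v, v \in s & \big[Num.min/a]_(v <- s) g v = g v.
Proof.
elim: s => [|w s IH]; first by rewrite big_nil; left.
rewrite big_cons; case: leP => _; first by right; exists w; rewrite ?inE ?eqxx.
by case: IH => [|[v vs E]]; [left|right; exists v; rewrite // inE vs orbT].
Qed.

End Generic.

Section Flat.
Variables (R : realType) (d : nat) (Om : set 'rV[R]_d) (u : 'rV[R]_d -> R).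
Implicit Types (x y z : 'rV[R]_d).
Hypothesis ju : forall n (c : 'I_n -> R) (p : 'I_n -> 'rV[R]_d), weights c ->
  (forall i, closure Om (p i)) -> u (\sum_i c i *: p i) <= \sum_i c i * u (p i).

Lemma max_weight n (c : 'I_n.+1 -> R) : weights c -> exists j, 1 <= c j * n.+1%:R.
Proof.
move=> wc; have en : enum 'I_n.+1 != [::] by rewrite -size_eq0 size_enum_ord.
have [j _ jmax] := seq_argmax c en.
exists j; rewrite -[X in X <= _]wc.2 mulr_natr -[X in c j *+ X]card_ord -sumr_const.
by apply: ler_sum => i _; apply: jmax; rewrite mem_enum.
Qed.

(** When Jensen's inequality is an equality at x, the function is affine on the
    simplex spanned by the y i; the segment from y j through x can be extended
    beyond x because the weight of y j is not too small. *)
Lemma flat_segment n (c : 'I_n.+2 -> R) (y : 'I_n.+2 -> 'rV[R]_d) x j (t : R) :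
  weights c -> (forall i, closure Om (y i)) -> x = \sum_i c i *: y i ->
  \sum_i c i * u (y i) <= u x -> 1 <= c j * n.+2%:R ->
  0 <= t -> t * n.+1%:R <= 1 ->
  u (x + t *: (y j - x)) + u (x - t *: (y j - x)) <= 2 * u x.
Proof.
move=> wc cy xE ux cj t0 tn.
pose e (i : 'I_n.+2) : R := (i == j)%:R.
have se : \sum_i e i = 1.
  by rewrite (bigD1 j)//= /e eqxx big1 ?addr0// => i ij; rewrite (negPf ij).
have sy : \sum_i e i *: y i = y j.
  rewrite (bigD1 j)//= /e eqxx scale1r big1 ?addr0// => i ij.
  by rewrite (negPf ij) scale0r.
have su : \sum_i e i * u (y i) = u (y j).
  rewrite (bigD1 j)//= /e eqxx mul1r big1 ?addr0// => i ij.
  by rewrite (negPf ij) mul0r.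
have n1 : 1 <= n.+1%:R :> R by rewrite ler1n.
have nS : n.+2%:R = n.+1%:R + 1 :> R by rewrite -natr1.
have t1 : t <= 1 by nra.
have step s : (forall i, 0 <= (1 - s) * c i + s * e i) ->
    u (x + s *: (y j - x)) <= (1 - s) * \sum_i c i * u (y i) + s * u (y j).
  move=> sc; pose c' i := (1 - s) * c i + s * e i.
  have wc' : weights c'.
    by split=> //; rewrite big_split/= -!mulr_sumr wc.2 se; ring.
  have E : x + s *: (y j - x) = \sum_i c' i *: y i.
    rewrite /c'; under eq_bigr do rewrite scalerDl -!scalerA.
    by rewrite big_split/= -!scaler_sumr sy -xE; apply/rowP => l; rewrite !mxE; ring.
  rewrite E; apply: le_trans (ju wc' cy) _.
  rewrite /c'; under eq_bigr do rewrite mulrDl -!mulrA.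
  by rewrite big_split/= -!mulr_sumr su.
have := step t; have := step (- t).
rewrite scaleNr => H1 H2.
have {}H2 : u (x + t *: (y j - x)) <= (1 - t) * \sum_i c i * u (y i) + t * u (y j).
  apply: H2 => i; have ci := wc.1 i; have ei : 0 <= e i by rewrite /e ler0n.
  by rewrite addr_ge0// mulr_ge0// subr_ge0.
have {}H1 : u (x - t *: (y j - x)) <= (1 + t) * \sum_i c i * u (y i) - t * u (y j).
  have -> : (1 + t) * \sum_i c i * u (y i) - t * u (y j) =
    (1 - - t) * \sum_i c i * u (y i) + - t * u (y j) by ring.
  apply: H1 => i; rewrite opprK /e; have := wc.1 i.
  have [->|ij] := eqVneq i j; last by move=> ci; rewrite mulr0 addr0 mulr_ge0//; lra.
  rewrite mulr1 => ci.
  rewrite -(@pmulr_lge0 _ n.+2%:R) ?ltr0n// mulrDl -mulrA.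
  have : (1 + t) * 1 <= (1 + t) * (c j * n.+2%:R) by rewrite ler_wpM2l//; lra.
  rewrite nS; nra.
lra.
Qed.

End Flat.

(** * Discrete comparison *)

Section Comparison.
Variables (R : realType) (d : nat) (Om : set 'rV[R]_d) (f : 'rV[R]_d -> R).
Variables (sigma : R) (k : nat) (alpha : R) (Th : seq 'M[R]_(d.+1, d)).
Variables (delta theta : R) (S : seq 'rV[R]_d) (w : 'rV[R]_d -> R).
Hypotheses (d0 : (0 < d)%N) (oO : open Om) (bO : bounded_set Om).
Hypothesis scO : strictly_convex Om.
Let u := convex_envelope Om f.
Let su := holder_seminorm k alpha Om u.
Let sf := holder_seminorm k alpha Om f.
Let h := mesh_size Th.
Let G := mesh_domain Th.
Let beta : R := k%:R + alpha.
Hypothesis cf : {within closure Om, continuous f}.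
Hypotheses (k01 : k = 0%N \/ k = 1%N) (a0 : 0 < alpha) (a1 : alpha <= 1).
Hypotheses (hu : holder_class k alpha Om u) (hf : holder_class k alpha Om f).
Hypothesis su0 : 0 < su.
Hypothesis adm : admissible_mesh Om sigma Th.
Hypotheses (h0 : 0 < h) (hd : h <= delta) (th1 : theta <= 1).
Hypothesis dth : delta * theta <= h.
Hypothesis net : direction_net theta S.
Hypothesis sol : discrete_solution Om Th delta S f w.
Implicit Types (x y z v : 'rV[R]_d) (P : 'M[R]_(d.+1, d)).

Let de0 : 0 < delta. Proof. exact: lt_le_trans hd. Qed.
Let sf0 : 0 <= sf. Proof. exact: holder_seminorm_ge0 hf. Qed.
Let D1 : 1 <= d%:R :> R. Proof. by rewrite ler1n. Qed.
Let beta0 : 0 < beta. Proof. by rewrite ltr_wpDl. Qed.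
Let beta2 : beta <= 2.
Proof.
have : k%:R <= 1 :> R by rewrite lern1; case: k01 => ->.
rewrite /beta; have := a1; lra.
Qed.

Let uf x : closure Om x -> u x <= f x.
Proof. exact: envelope_le. Qed.

Let ju n (c : 'I_n -> R) (p : 'I_n -> 'rV[R]_d) : weights c ->
  (forall i, closure Om (p i)) -> u (\sum_i c i *: p i) <= \sum_i c i * u (p i).
Proof. exact: envelope_jensen. Qed.

Let oG : open G. Proof. exact: mesh_domain_open. Qed.
Let bG : bounded_set G := mesh_domain_bounded bO adm.
Let cG : convex_closed G := mesh_domain_convex adm.
Let GOm x : G x -> Om x. Proof. exact: (mesh_domain_sub adm). Qed.
Let cGOm x : closure G x -> closure Om x.
Proof. by move=> cx; refine (closure_subset _ cx); exact: (mesh_domain_sub adm). Qed.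
Let inG x : inode Om Th x -> G x. Proof. exact: (inode_domain adm). Qed.

Lemma fe_combination P x : P \in Th -> simplex P x ->
  w x = \sum_i bary P i x * w (row i P).
Proof.
move=> PT Px; have Pn := mesh_nondegenerate adm PT.
have [[_ /(_ P PT)[l al wl]] _ _] := sol.
rewrite wl// -{1}(bary_combination x Pn) (affine_sum _ al (bary_sum P x)).
by apply: eq_bigr => i _; rewrite wl//; exact: vertex_simplex.
Qed.

Lemma node_argmax (g : 'rV[R]_d -> R) :
  exists2 x, node Th x & forall z, node Th z -> g z <= g x.
Proof.
pose nodes := [seq row i P | P <- Th, i <- enum 'I_d.+1].
have nodesP x : node Th x <-> x \in nodes.
  split=> [[P PT [i ->]]|/allpairsP[[P i] /= [PT _ ->]]]; last by exists P => //; exists i.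
  by apply/allpairsP; exists (P, i); split => //=; rewrite mem_enum.
have : nodes != [::].
  have : exists P, P \in Th.
    move: h0; rewrite /h /mesh_size; case: (Th) => [|P s].
      by rewrite big_nil ltxx.
    by exists P; rewrite inE eqxx.
  move=> [P PT]; apply/eqP => E.
  have := (nodesP (row ord0 P)).1 (cell_node _ PT); by rewrite E in_nil.
by move=> /(seq_argmax g)[x /nodesP nx xmax]; exists x => // z /nodesP /xmax.
Qed.

Lemma inode_step x : inode Om Th x -> 0 < delta_node Th delta x /\
  forall v, enorm v = 1 -> closure G (x + delta_node Th delta x *: v) /\
                           closure G (x - delta_node Th delta x *: v).
Proof.
move=> /inG Gx; have s0 := dist_boundary_gt0 d0 oG bG Gx.
have ds : delta_node Th delta x <= dist x (boundary G) by rewrite ge_min lexx orbT.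
have dn0 : 0 < delta_node Th delta x by rewrite lt_min de0.
split => // v v1; split; apply: (le_dist_boundary d0 oG bG Gx).
  by rewrite addrAC subrr add0r enormZ v1 mulr1 gtr0_norm.
by rewrite addrAC subrr add0r enormN enormZ v1 mulr1 gtr0_norm.
Qed.

Lemma T_eps_zero x : inode Om Th x ->
  let di := delta_node Th delta x in
  [/\ w x <= f x,
      forall v, v \in S -> 2 * w x <= w (x + di *: v) + w (x - di *: v)
    & w x = f x \/
      exists2 v, v \in S & w (x + di *: v) + w (x - di *: v) = 2 * w x].
Proof.
move=> ix di; have [di0 _] := inode_step ix.
have [_ /(_ x ix) T0 _] := sol.
have [H1 H2] := bigmin_seq_le S (second_diff Th delta w x) (f x - w x).
have d2 : 0 < di ^+ 2 by rewrite exprn_gt0.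
split.
- by rewrite -subr_ge0 -T0.
- move=> v /H2; rewrite -/(T_eps _ _ _ _ _ _) T0 /second_diff -/di.
  by rewrite pmulr_lge0 ?invr_gt0//; lra.
have := bigmin_seq_attained S (second_diff Th delta w x) (f x - w x).
rewrite -/(T_eps _ _ _ _ _ _) T0 => -[E|[v vS E]].
  by left; lra.
right; exists v => //; move: E; rewrite /second_diff -/di => /esym/eqP.
by rewrite mulf_eq0 invr_eq0 (gt_eqF d2) orbF => /eqP; lra.
Qed.

Variable rho : R.
Hypothesis rhoO : forall x, closure Om x -> enorm x <= rho.

Let sqr_combination n (c : 'I_n -> R) (q : 'I_n -> 'rV[R]_d) : weights c ->
  dotp (\sum_i c i *: q i) (\sum_i c i *: q i) <= \sum_i c i * dotp (q i) (q i).
Proof.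
move=> wc; set p := \sum_i c i *: q i.
have : 0 <= \sum_i c i * dotp (q i - p) (q i - p).
  by apply: sumr_ge0 => i _; rewrite mulr_ge0 ?dotp_ge0// wc.1.
have -> : \sum_i c i * dotp (q i - p) (q i - p) =
    \sum_i c i * dotp (q i) (q i) - 2 * dotp p p + dotp p p.
  have E : \sum_i c i * dotp (q i) p = dotp p p.
    rewrite {2 3}/p dotp_sumr; apply: eq_bigr => i _.
    by rewrite dotpZr dotpC.
  under eq_bigr do rewrite dotp_sqrB mulrDr mulrBr mulrCA.
  by rewrite big_split sumrB/= -mulr_sumr E -mulr_suml wc.2 mul1r.
lra.
Qed.

Let sqr_step x v (t : R) : enorm v = 1 ->
  dotp (x + t *: v) (x + t *: v) + dotp (x - t *: v) (x - t *: v)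
  = 2 * dotp x x + 2 * t ^+ 2.
Proof.
move=> v1; rewrite dotp_sqrD dotp_sqrB !dotpZr !dotpZl -(sqr_enorm v) v1; ring.
Qed.

(** Linear interpolation does not decrease a convex function, so u is a discrete
    subsolution at no cost. A small multiple of the squared norm makes it strict,
    and u - w plus this multiple cannot be maximal at an interior node where w < u. *)
Lemma envelope_le_nodes z : node Th z -> u z <= w z.
Proof.
move=> nz; have rho0 : 0 <= rho.
  by apply: le_trans (enorm_ge0 z) (rhoO (cGOm (node_closure adm nz))).
suff H e : 0 < e -> u z <= w z + e * rho ^+ 2.
  apply/ler_addgt0Pr => e e0; have r1 : 0 < rho ^+ 2 + 1 by rewrite ltr_wpDl// exprn_ge0.
  apply: le_trans (H (e / (rho ^+ 2 + 1)) (divr_gt0 e0 r1)) _.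
  rewrite lerD2l mulrAC ler_pdivrMr// ler_pM2l//; lra.
move=> e0; pose g z := u z - w z + e * dotp z z.
have [x nx xmax] := node_argmax g.
have sqle y : closure G y -> dotp y y <= rho ^+ 2.
  move=> /cGOm /rhoO H; rewrite -sqr_enorm ler_pXn2r ?nnegrE ?enorm_ge0//.
suff gx : g x <= e * rho ^+ 2.
  have := xmax z nz; rewrite /g in gx *; have := dotp_ge0 z.
  have : 0 <= e * dotp z z by rewrite mulr_ge0 ?dotp_ge0// ltW.
  lra.
have ex : e * dotp x x <= e * rho ^+ 2.
  by rewrite ler_pM2l// sqle//; exact (node_closure adm nx).
have [bx|nbx] := pselect (bnode Om Th x).
  have [_ _ /(_ x bx) wE] := sol; rewrite /g wE.
  have -> : u x = f x by apply: envelope_boundary => //; case: bx.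
  lra.
have ix : inode Om Th x by [].
rewrite leNgt; apply/negP => gx.
have Gx := inG ix.
have wu : w x < u x by rewrite /g in gx; lra.
have [_ _ [wf|[v vS wE]]] := T_eps_zero ix.
  by have := uf (subset_closure (GOm Gx)); lra.
set di := delta_node Th delta x in wE.
have [di0 /(_ v (net.1 v vS))[cp cm]] := inode_step ix; rewrite -/di in di0 cp cm.
have cell p : closure G p -> u p - w p + e * dotp p p <= g x.
  move=> cp'; have [P PT Pp] := mesh_domain_cell adm cp'.
  have Pn := mesh_nondegenerate adm PT; have wP := bary_weights Pn Pp.
  have : \sum_i bary P i p * g (row i P) <= g x.
    by apply: weights_avg_le => // i _; apply: xmax; exact: cell_node.
  apply: le_trans; rewrite /g.
  under [leRHS]eq_bigr do rewrite mulrDr mulrBr mulrCA.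
  rewrite big_split sumrB/= -(fe_combination PT Pp) -mulr_sumr.
  have U := ju wP (fun i => cGOm (node_closure adm (cell_node i PT))).
  have Q := sqr_combination (fun i => row i P) wP.
  rewrite bary_combination// in U Q.
  have : e * dotp p p <= e * \sum_i bary P i p * dotp (row i P) (row i P).
    by rewrite ler_pM2l.
  lra.
have := cell _ cp; have := cell _ cm.
have := sqr_step x di (net.1 v vS).
have U : 2 * u x <= u (x + di *: v) + u (x - di *: v).
  have wc : weights (fun _ : 'I_2 => 2^-1 : R).
    by split=> [i|]; rewrite ?invr_ge0// !big_ord_recl big_ord0 addr0; lra.
  have := ju (p := fun i : 'I_2 => if i == ord0 then x + di *: v else x - di *: v) wc.
  rewrite !big_ord_recl !big_ord0 !addr0 /= => H.
  have xE : 2^-1 *: (x + di *: v) + 2^-1 *: (x - di *: v) = x.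
    by apply/rowP => i; rewrite !mxE; field.
  suff : u x <= 2^-1 * u (x + di *: v) + 2^-1 * u (x - di *: v) by lra.
  by rewrite xE in H; apply: H => i; case: ifP => _; exact: cGOm.
rewrite /g => sq.
have : 0 < e * di ^+ 2 by rewrite mulr_gt0// exprn_gt0.
have : e * (dotp (x + di *: v) (x + di *: v) + dotp (x - di *: v) (x - di *: v))
   = e * (2 * dotp x x + 2 * di ^+ 2) by rewrite sq.
rewrite !mulrDr; lra.
Qed.

Lemma envelope_le_solution x : G x -> u x <= w x.
Proof.
move=> Gx; have [P PT Px] := mesh_domain_cell adm (subset_closure Gx).
have Pn := mesh_nondegenerate adm PT; have wP := bary_weights Pn Px.
rewrite (fe_combination PT Px) -{1}(bary_combination x Pn).
apply: le_trans (ju wP _) _.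
  by move=> i; apply: cGOm; exact (node_closure adm (cell_node i PT)).
by apply: weights_le => // i _; apply: envelope_le_nodes; exact: cell_node.
Qed.

(** The coefficients of the terms that make u a strict supersolution U: K1 bounds
    f - u close to the contact set, K2 beats the interpolation error and the error
    of the direction net far from the boundary, K3 beats the interpolation error
    and the curvature of u in the layer of width M * delta. A direction in which u
    is flat at x can be followed on both sides of x as far as 1 / M times the
    distance of x to the contact point. *)
Let M : R := (d + 1).+1%:R.
Let D : R := d%:R.
Let K1 : R := D * (M + 1) ^+ 2 * (su + sf) * delta `^ beta.
Let K2 : R := 3 * (D * su * h `^ beta) / delta ^+ 2.
Let K3 : R := 32 * M ^+ 2 * (D * su * (1 + sigma)) * delta `^ (beta - 2^-1).
Let b := barrier G (M * delta).
Let U z : R := u z + K1 + K3 * b z + K2 * (rho ^+ 2 - dotp z z).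

Let M1 : 1 <= M. Proof. by rewrite ler1n. Qed.

Let powR_mono (r s : R) : 0 <= r -> r <= s -> r `^ beta <= s `^ beta.
Proof.
move=> r0 rs; apply: ge0_ler_powR; rewrite ?nnegrE ?(ltW beta0)//.
exact: le_trans rs.
Qed.

Let K1_ge0 : 0 <= K1.
Proof. by rewrite !mulr_ge0 ?powR_ge0 ?exprn_ge0 ?addr_ge0 ?(ltW su0)// ?ler0n. Qed.

Let Dsuh : 0 < D * su * h `^ beta.
Proof. by rewrite !mulr_gt0// ?powR_gt0// ltr0n. Qed.

Let K2_gt0 : 0 < K2.
Proof. by rewrite divr_gt0 ?exprn_gt0// mulr_gt0. Qed.

Let sigma_ge0 x : G x -> 0 <= sigma.
Proof.
move=> Gx; have [P PT _] := mesh_domain_cell adm (subset_closure Gx).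
by rewrite ltW//; have [] := sigma_inradius d0 adm PT.
Qed.

Let K3_ge0 x : G x -> 0 <= K3.
Proof.
move=> /sigma_ge0 s0; rewrite !mulr_ge0 ?powR_ge0 ?addr_ge0 ?(ltW su0)//.
Qed.

Lemma obstacle_le x (r : R) : G x -> f x <= u x + D * (su + sf) * r `^ beta ->
  0 <= r -> r <= (M + 1) * delta -> f x <= U x.
Proof.
move=> Gx H r0 rM.
have M10 : 1 <= M + 1 by have := M1; lra.
have rK : D * (su + sf) * r `^ beta <= K1.
  have Hr : r `^ beta <= (M + 1) ^+ 2 * delta `^ beta.
    apply: le_trans (powR_mono r0 rM) _.
    rewrite powRM ?(ltW de0)//; last by lra.
    rewrite ler_wpM2r ?powR_ge0// -powR_mulrn; last lra.
    exact: ler_powR.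
  have -> : K1 = D * (su + sf) * ((M + 1) ^+ 2 * delta `^ beta) by rewrite /K1; ring.
  by rewrite ler_wpM2l// mulr_ge0 ?addr_ge0 ?(ltW su0)// ler0n.
have b0 : 0 <= K3 * b x by rewrite mulr_ge0 ?(K3_ge0 Gx) ?barrier_ge0.
have q0 : 0 <= K2 * (rho ^+ 2 - dotp x x).
  rewrite mulr_ge0 ?(ltW K2_gt0)// subr_ge0 -sqr_enorm.
  have xr := rhoO (cGOm (subset_closure Gx)).
  rewrite ler_pXn2r ?nnegrE ?enorm_ge0//.
  exact: le_trans (enorm_ge0 x) xr.
rewrite /U; lra.
Qed.

Let U_second_difference x v (t : R) : enorm v = 1 ->
  U (x + t *: v) + U (x - t *: v) - 2 * U x =
  (u (x + t *: v) + u (x - t *: v) - 2 * u x)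
  + K3 * (b (x + t *: v) + b (x - t *: v) - 2 * b x) - 2 * K2 * t ^+ 2.
Proof.
move=> v1; rewrite /U.
have -> : dotp (x + t *: v) (x + t *: v) =
    2 * dotp x x + 2 * t ^+ 2 - dotp (x - t *: v) (x - t *: v).
  by rewrite -(sqr_step x t v1); ring.
ring.
Qed.

(** A boundary node is a contact point, and by [near_bnode] the layer is close to the
    boundary nodes. *)
Let layer_obstacle x : k = 0%N -> inode Om Th x ->
  dist x (boundary G) <= M * delta -> f x <= U x.
Proof.
move=> kE ix sM; have Gx := inG ix.
have [m [n [y [sm _ _ _ [By my xy]]]]] := exists_supporting d0 oG bG cG Gx.
have cy : closure G y by case: By.
have [z bz zy] := near_bnode adm sm cy my.
have cz : closure Om z by case: bz => _ [].
have uz : u z = f z by apply: envelope_boundary => //; case: bz.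
have cx := cGOm (subset_closure Gx).
have Hu := holder0 scO a0 kE hu cx cz.
have Hf := holder0 scO a0 kE hf cx cz.
rewrite -/su -/sf in Hu Hf.
apply: (@obstacle_le x (enorm (x - z))) => //.
- rewrite /beta kE add0r.
  have pw := powR_ge0 (enorm (x - z)) alpha.
  have : (su + sf) * enorm (x - z) `^ alpha <= D * (su + sf) * enorm (x - z) `^ alpha.
    by rewrite -mulrA ler_peMl// mulr_ge0// addr_ge0// ltW.
  by move: Hu Hf; rewrite !ler_norml uz; lra.
- exact: enorm_ge0.
- have -> : x - z = (x - y) + (y - z) by rewrite addrA subrK.
  apply: le_trans (enormD _ _) _; rewrite (enormC y) xy.
  have := hd; rewrite /h; lra.
Qed.

(** For k = 1 the second differences of u, of order beta >= 1 in the step, are beaten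
    by those of the barrier, of order 1 / 2 in the distance to the boundary; the
    step and, by [inode_dist], the mesh size are bounded by this distance. *)
Let layer_barrier x : k = 1%N -> inode Om Th x ->
  dist x (boundary G) <= M * delta -> exists2 v, v \in S &
  let di := delta_node Th delta x in
  U (x + di *: v) + U (x - di *: v) - 2 * U x + 2 * (D * su * h `^ beta) < 0.
Proof.
move=> kE ix sM; have Gx := inG ix.
have [v vS] := barrier_layer d0 oG bG cG M1 de0 th1 net Gx sM.
rewrite -/(delta_node Th delta x) -/b => bv; exists v => //=.
set di := delta_node Th delta x in bv *; set s := dist _ _ in sM bv.
have v1 := net.1 v vS.
have [di0 /(_ v v1)[cp cm]] := inode_step ix; rewrite -/di in di0 cp cm.
rewrite (U_second_difference x di v1).
have hu2 := second_difference_le oO scO a0 k01 d0 hu (cGOm cp) (cGOm cm).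
rewrite -/su enormZ v1 mulr1 gtr0_norm// -/beta in hu2.
have [sg0 hs] := inode_dist d0 bO adm ix; rewrite -/s in hs.
have s0 : 0 <= s by rewrite /s; exact: ltW (dist_boundary_gt0 d0 oG bG Gx).
have dis : di <= s by rewrite /di ge_min lexx orbT.
have did : di <= delta by rewrite /di ge_min lexx.
have b12 : 0 <= beta - 2^-1 by rewrite /beta kE; have := a0; lra.
have split_pow (r t : R) : 0 <= r -> r <= delta -> r <= t ->
    r `^ beta <= delta `^ (beta - 2^-1) * Num.sqrt t.
  move=> r0 rd rt; have -> : beta = (beta - 2^-1) + 2^-1 by ring.
  rewrite powRD; last by apply/implyP; rewrite subrK gt_eqF.
  rewrite addrK powR12_sqrt//; apply: ler_pM; rewrite ?powR_ge0 ?sqrtr_ge0//.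
    by apply: ge0_ler_powR; rewrite ?nnegrE// ltW.
  by rewrite ler_sqrt//; exact: le_trans rt.
have pdi := split_pow di s (ltW di0) did dis.
have ph := split_pow h (sigma ^+ 2 * s) (ltW h0) hd hs.
rewrite sqrtrM ?sqr_ge0// sqrtr_sqr (ger0_norm (ltW sg0)) in ph.
set p := delta `^ (beta - 2^-1) * Num.sqrt s in pdi.
have ph' : h `^ beta <= sigma * p by rewrite /p mulrCA.
have K3b : K3 * (b (x + di *: v) + b (x - di *: v) - 2 * b x)
    <= - (2 * (D * su * (1 + sigma)) * p).
  apply: le_trans (ler_wpM2l (K3_ge0 Gx) bv) _.
  rewrite /K3 /p le_eqVlt; apply/orP; left; apply/eqP.
  have : M != 0 by rewrite gt_eqF// (lt_le_trans ltr01 M1).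
  move: (M) (Num.sqrt s) (delta `^ _) => M' q1 q2 Mn; field.
  by [].
have Dsu0 : 0 < D * su by rewrite mulr_gt0// ltr0n.
have : 0 < K2 * di ^+ 2 by rewrite mulr_gt0// exprn_gt0.
have : D * su * di `^ beta <= D * su * p by rewrite ler_pM2l.
have : D * su * h `^ beta <= D * su * (sigma * p) by rewrite ler_pM2l.
have E : 2 * (D * su * (1 + sigma)) * p =
  2 * (D * su * p) + 2 * (D * su * (sigma * p)) by ring.
rewrite E in K3b; move: hu2; rewrite -/D; lra.
Qed.

(** The value of u at x is a mean of values of f at contact points. If the one of
    largest weight is close to x, then f - u is small at x; otherwise u is flat in
    its direction. *)
Let inner_supersolution x : inode Om Th x -> M * delta < dist x (boundary G) ->
  f x <= U x \/ exists2 v, v \in S &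
  let di := delta_node Th delta x in
  U (x + di *: v) + U (x - di *: v) - 2 * U x + 2 * (D * su * h `^ beta) < 0.
Proof.
move=> ix sM; have Gx := inG ix; have Ox := GOm Gx.
have [c [y [wc cy xE uE]]] := envelope_attained bO cf (subset_closure Ox).
rewrite -/u in uE.
have [j cj] := max_weight wc.
have cj0 : 0 < c j.
  by rewrite -(@pmulr_lgt0 _ (d + 1).+2%:R) ?ltr0n//; exact: lt_le_trans cj.
have [near|far] := ltP (enorm (x - y j)) (M * delta).
  left; apply: (@obstacle_le x (enorm (x - y j))) => //.
  - apply: (near_contact oO scO k01 a0 hu (@ju) d0 hf (@uf) Ox wc cy xE uE cj0).
    right; apply: GOm; apply: (lt_dist_boundary oG Gx).
    by rewrite enormC; exact: lt_trans sM.
  - exact: enorm_ge0.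
  - by apply: le_trans (ltW near) _; rewrite mulrDl mul1r lerDl ltW.
right; have M0 : 0 < M := lt_le_trans ltr01 M1.
have e0 : 0 < enorm (x - y j) by apply: lt_le_trans far; rewrite mulr_gt0.
pose v := (enorm (x - y j))^-1 *: (y j - x).
have v1 : enorm v = 1.
  by rewrite enormZ (enormC (y j)) ger0_norm ?invr_ge0 ?enorm_ge0// mulVf// gt_eqF.
have [v' v'S vv'] := net.2 v v1; exists v' => //=.
have diE : delta_node Th delta x = delta.
  rewrite /delta_node min_l//; apply: le_trans (ltW sM); rewrite ler_peMl//.
  exact: ltW.
rewrite diE (U_second_difference x delta (net.1 v' v'S)).
have inO z : enorm (z - x) = delta -> G z.
  move=> zx; apply: (lt_dist_boundary oG Gx); rewrite zx.
  by apply: le_lt_trans sM; rewrite ler_peMl// ltW.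
have inOp z : enorm z = 1 -> G (x + delta *: z).
  by move=> z1; apply: inO; rewrite addrAC subrr add0r enormZ z1 mulr1 gtr0_norm.
have inOm z : enorm z = 1 -> G (x - delta *: z).
  move=> z1; apply: inO.
  by rewrite addrAC subrr add0r enormN enormZ z1 mulr1 gtr0_norm.
have flat : u (x + delta *: v) + u (x - delta *: v) <= 2 * u x.
  rewrite /v scalerA; apply: (flat_segment (@ju) wc cy xE _ cj).
  - by rewrite uE; apply: weights_le => // i _; exact: uf.
  - by rewrite divr_ge0 ?enorm_ge0// ltW.
  - rewrite mulrAC ler_pdivrMr// mul1r mulrC; exact: far.
have v'1 := net.1 v' v'S.
have := flat_direction oO scO k01 a0 hu (@ju) d0 Ox (GOm (inOp _ v1))
  (GOm (inOm _ v1)) (GOm (inOp _ v'1)) (GOm (inOm _ v'1)) flat.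
rewrite -/su -/beta -scalerBr enormZ gtr0_norm// => Hu.
have pw : (delta * enorm (v - v')) `^ beta <= h `^ beta.
  apply: powR_mono; first by rewrite mulr_ge0 ?enorm_ge0// ltW.
  by apply: le_trans dth; rewrite ler_pM2l.
have Hb := barrier_concave2 d0 oG bG cG (M * delta) Gx
  (subset_closure (inOp _ v'1)) (subset_closure (inOm _ v'1)).
rewrite -/b in Hb.
have : K3 * (b (x + delta *: v') + b (x - delta *: v') - 2 * b x) <= 0.
  by rewrite mulr_ge0_le0 ?(K3_ge0 Gx)//; lra.
have -> : 2 * K2 * delta ^+ 2 = 6 * (D * su * h `^ beta).
  by rewrite /K2; field; rewrite gt_eqF.
have Dsu0 : 0 < D * su by rewrite mulr_gt0// ltr0n.
have : D * su * (delta * enorm (v - v')) `^ beta <= D * su * h `^ beta by rewrite ler_pM2l.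
have := Dsuh; move: Hu; rewrite -/D; lra.
Qed.

Lemma strict_supersolution x : inode Om Th x -> f x <= U x \/
  exists2 v, v \in S & let di := delta_node Th delta x in
  U (x + di *: v) + U (x - di *: v) - 2 * U x + 2 * (D * su * h `^ beta) < 0.
Proof.
move=> ix; have [sM|sM] := leP (dist x (boundary G)) (M * delta).
  case: k01 => kE; first by left; exact: layer_obstacle.
  by right; exact: layer_barrier.
exact: inner_supersolution.
Qed.

Let U_cell P p : P \in Th -> simplex P p ->
  \sum_i bary P i p * U (row i P) <= U p + D * su * h `^ beta.
Proof.
move=> PT Pp; have Pn := mesh_nondegenerate adm PT; have wP := bary_weights Pn Pp.
have cG' i : closure G (row i P) := node_closure adm (cell_node i PT).
have pE : p = \sum_i bary P i p *: row i P by rewrite bary_combination.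
have [z0 Gz0 _] := (closure_enormP G _).1 (cG' ord0) 1 ltr01.
have Hu := jensen_gap oO scO a0 k01 d0 hu wP pE (fun i => cGOm (cG' i))
  (fun i _ => vertex_dist_le adm i PT Pp).
have Hb := barrier_jensen d0 oG bG cG (M * delta) Gz0 wP cG'.
have Hq := sqr_combination (fun i => row i P) wP.
rewrite -pE -/b in Hb; rewrite -pE in Hq; rewrite -/su -/beta -/D -/h in Hu.
have -> : \sum_i bary P i p * U (row i P) =
    \sum_i bary P i p * u (row i P) + K1 + K3 * (\sum_i bary P i p * b (row i P))
    + K2 * (rho ^+ 2 - \sum_i bary P i p * dotp (row i P) (row i P)).
  rewrite -[K1 in RHS]mul1r -[rho ^+ 2 in RHS]mul1r -wP.2.
  rewrite !mulr_suml -sumrB !mulr_sumr -!big_split; apply: eq_bigr => i _ /=.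
  rewrite /U; ring.
have : K3 * (\sum_i bary P i p * b (row i P)) <= K3 * b p.
  by rewrite ler_wpM2l// (K3_ge0 Gz0).
have : K2 * (rho ^+ 2 - \sum_i bary P i p * dotp (row i P) (row i P))
    <= K2 * (rho ^+ 2 - dotp p p).
  by rewrite ler_pM2l//; lra.
rewrite /U; lra.
Qed.

(** At a maximum of w - U over the nodes the second differences of w are at
    most those of U plus the interpolation error of U, which is that of u because
    the other terms are concave; this is negative by [strict_supersolution]. *)
Lemma solution_le_nodes z : node Th z -> w z <= U z.
Proof.
move=> nz; pose g z := w z - U z.
have [x nx xmax] := node_argmax g.
suff : g x <= 0 by have := xmax z nz; rewrite /g; lra.
have cx := node_closure adm nx.
have Ux : u x <= U x.
  have [y Gy _] := (closure_enormP G x).1 cx 1 ltr01.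
  have : 0 <= K3 * b x by rewrite mulr_ge0 ?(K3_ge0 Gy) ?barrier_ge0.
  have : 0 <= K2 * (rho ^+ 2 - dotp x x).
    rewrite mulr_ge0 ?(ltW K2_gt0)// subr_ge0 -sqr_enorm.
    have xr := rhoO (cGOm cx).
    rewrite ler_pXn2r ?nnegrE ?enorm_ge0//; exact: le_trans (enorm_ge0 x) xr.
  have := K1_ge0; rewrite /U; lra.
have [bx|nbx] := pselect (bnode Om Th x).
  have [_ _ /(_ x bx) wE] := sol; rewrite /g wE subr_le0.
  have <- : u x = f x by apply: envelope_boundary => //; case: bx.
  exact: Ux.
have ix : inode Om Th x by [].
have [wf wS _] := T_eps_zero ix.
have [fU|[v vS]] := strict_supersolution ix; first by rewrite /g; lra.
set di := delta_node Th delta x in wS * => /= Uneg.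
have [di0 /(_ v (net.1 v vS))[cp cm]] := inode_step ix; rewrite -/di in di0 cp cm.
have cell p : closure G p -> w p <= g x + U p + D * su * h `^ beta.
  move=> cp'; have [P PT Pp] := mesh_domain_cell adm cp'.
  have Pn := mesh_nondegenerate adm PT; have wP := bary_weights Pn Pp.
  rewrite (fe_combination PT Pp).
  have := U_cell PT Pp.
  have : \sum_i bary P i p * g (row i P) <= g x.
    by apply: weights_avg_le => // i _; apply: xmax; exact: cell_node.
  rewrite /g; under eq_bigr do rewrite mulrBr.
  rewrite sumrB; lra.
have := cell _ cp; have := cell _ cm; have := wS v vS.
rewrite /g; lra.
Qed.

Lemma comparison x : G x -> u x <= w x /\
  w x <= u x + D * su * h `^ beta + K1 + K3 * Num.sqrt (M * delta) + K2 * rho ^+ 2.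
Proof.
move=> Gx; split; first exact: envelope_le_solution.
have [P PT Px] := mesh_domain_cell adm (subset_closure Gx).
have Pn := mesh_nondegenerate adm PT; have wP := bary_weights Pn Px.
have := U_cell PT Px; rewrite (fe_combination PT Px).
have : \sum_i bary P i x * w (row i P) <= \sum_i bary P i x * U (row i P).
  by apply: weights_le => // i _; apply: solution_le_nodes; exact: cell_node.
have : K3 * b x <= K3 * Num.sqrt (M * delta).
  by rewrite ler_wpM2l ?(K3_ge0 Gx)//; exact: barrier_bounded.
have : 0 <= K2 * dotp x x by rewrite mulr_ge0 ?dotp_ge0 ?(ltW K2_gt0).
rewrite /U mulrBr; lra.
Qed.

End Comparison.

(** * Balancing the errors *)

Section Exponents.
Variable R : realType.

(** With [r = su / (su + sf) <= 1] one has [Ra = r `^ q], and the bound on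
    [su * h `^ beta / delta ^+ 2] amounts to [r <= r `^ (2 * q)], that is, to
    [2 * q <= 1]. *)
Lemma balance_constant (su sf h beta : R) (q := (2 + beta)^-1)
    (Ra := su `^ q * (su + sf) `^ (- q)) (delta := Ra * h `^ (beta / (2 + beta))) :
  0 < su -> 0 <= sf -> 0 < h -> 0 < beta -> h <= delta ->
  [/\ 0 < Ra, delta `^ beta <= h `^ (beta ^+ 2 / (2 + beta)),
      h `^ beta <= h `^ (beta ^+ 2 / (2 + beta)),
      su * h `^ beta / delta ^+ 2 <= (su + sf) * h `^ (beta ^+ 2 / (2 + beta))
    & delta * (Ra^-1 * h `^ (2 / (2 + beta))) = h].
Proof.
move=> su0 sf0 h0 b0 hd.
have T0 : 0 < su + sf by rewrite ltr_pwDl.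
have B0 : 0 < 2 + beta by rewrite addr_gt0.
have q0 : 0 < q by rewrite invr_gt0.
pose r := su / (su + sf).
have r0 : 0 < r by rewrite divr_gt0.
have r1 : r <= 1 by rewrite ler_pdivrMr// mul1r lerDl.
have RaE : Ra = r `^ q.
  rewrite /Ra /r powRM ?(ltW su0) ?invr_ge0 ?(ltW T0)//; congr (_ * _).
  by rewrite -(powR_inv1 (ltW T0)) -powRrM mulN1r.
have Ra0 : 0 < Ra by rewrite RaE powR_gt0.
have Ra1 : Ra <= 1.
  by rewrite RaE -[leRHS](powRr0 r); apply: ger_powR; rewrite ?r0 ?r1// ltW.
have de0 : 0 < delta by rewrite mulr_gt0// powR_gt0.
have deb : delta `^ beta <= h `^ (beta ^+ 2 / (2 + beta)).
  rewrite /delta powRM ?powR_ge0 ?(ltW Ra0)// -powRrM.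
  have -> : beta / (2 + beta) * beta = beta ^+ 2 / (2 + beta) by rewrite expr2 mulrAC.
  rewrite ger_pMl ?powR_gt0//.
  have <- : 1 `^ beta = 1 :> R by rewrite powR1.
  by apply: ge0_ler_powR; rewrite ?nnegrE ?(ltW b0) ?(ltW Ra0).
split => //.
- apply: le_trans deb; apply: ge0_ler_powR; rewrite ?nnegrE ?(ltW b0) ?(ltW h0)//.
  exact: ltW.
- have hE : h `^ beta = h `^ (beta ^+ 2 / (2 + beta)) * (h `^ (beta / (2 + beta))) ^+ 2.
    have pn := @powR_mulrn R (h `^ (beta / (2 + beta))) 2 (powR_ge0 _ _).
    rewrite -pn -powRrM -powRD; first by congr (h `^ _); field; lra.
    by apply/implyP => _; rewrite gt_eqF.
  have dE : delta ^+ 2 = Ra ^+ 2 * (h `^ (beta / (2 + beta))) ^+ 2 by rewrite exprMn.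
  rewrite ler_pdivrMr ?exprn_gt0// hE dE.
  set E := h `^ (beta ^+ 2 / _); set e2 := _ ^+ 2.
  have -> : (su + sf) * E * (Ra ^+ 2 * e2) = ((su + sf) * Ra ^+ 2) * (E * e2) by ring.
  rewrite ler_wpM2r ?mulr_ge0 ?powR_ge0 ?sqr_ge0//.
  rewrite [X in X <= _](_ : su = (su + sf) * r); last first.
    by rewrite /r mulrCA mulfV ?mulr1// gt_eqF.
  rewrite ler_pM2l// RaE -powR_mulrn ?powR_ge0// -powRrM.
  rewrite -[X in X <= _](powRr1 (ltW r0)); apply: ger_powR; rewrite ?r0 ?r1//.
  by rewrite mulrC ler_pdivrMr//; lra.
rewrite /delta mulrACA mulfV ?gt_eqF// mul1r -powRD.
  have -> : beta / (2 + beta) + 2 / (2 + beta) = 1 by field; lra.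
  by rewrite powRr1// ltW.
by apply/implyP => _; rewrite gt_eqF.
Qed.

End Exponents.

Theorem corollary3p8 (R : realType) (d : nat) (hd : (0 < d)%N)
    (Om : set 'rV[R]_d) (hOm_open : open Om) (hOm_bdd : bounded_set Om)
    (hOm_sconv : strictly_convex Om) (sigma : R) :
  exists C : R,
    forall (f : 'rV[R]_d -> R) (k : nat) (alpha : R)
           (Th : seq 'M[R]_(d.+1, d)) (delta theta : R) (S : seq 'rV[R]_d)
           (ueps : 'rV[R]_d -> R),
      let u := convex_envelope Om f in
      let su := holder_seminorm k alpha Om u in
      let sf := holder_seminorm k alpha Om f in
      let h := mesh_size Th in
      {within closure Om, continuous f} ->
      k = 0%N \/ k = 1%N ->
      0 < alpha <= 1 ->
      holder_class k alpha Om u ->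
      holder_class k alpha Om f ->
      0 < su ->
      admissible_mesh Om sigma Th ->
      delta = R_alpha k alpha Om f
              * h `^ ((k%:R + alpha) / (2 + k%:R + alpha)) ->
      theta = (R_alpha k alpha Om f)^-1 * h `^ (2 / (2 + k%:R + alpha)) ->
      h <= delta ->
      theta <= 1 ->
      direction_net theta S ->
      discrete_solution Om Th delta S f ueps ->
      (sup_norm (mesh_domain Th) (fun x => (u x - ueps x)%R)
       <= (C * (su + sf)
           * h `^ ((k%:R + alpha) ^+ 2 / (2 + k%:R + alpha)))%:E)%E.
Proof.
have [rho rho0 rhoO] := bounded_closure_enorm hOm_bdd.
pose M : R := (d + 1).+1%:R; pose D : R := d%:R.
exists (D + D * (M + 1) ^+ 2 + 32 * M ^+ 2 * D * (1 + `|sigma|) * Num.sqrt M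
        + 3 * D * rho ^+ 2).
move=> f k alpha Th delta theta S w u su sf h cf k01 /andP[a0 a1] hu hf su0 adm.
move=> deE thE hde th1 net sol.
apply: ge_ereal_sup => _ [x Gx <-]; rewrite lee_fin.
pose beta : R := k%:R + alpha.
have BE : 2 + k%:R + alpha = 2 + beta by rewrite addrA.
rewrite BE -/beta in deE thE *.
have [P PT _] := mesh_domain_cell adm (subset_closure Gx).
have h0 : 0 < h := mesh_size_gt0 hd adm PT.
have sg0 : 0 < sigma by have [] := sigma_inradius hd adm PT.
have sf0 : 0 <= sf := holder_seminorm_ge0 hf.
have b0 : 0 < beta by rewrite ltr_wpDl.
have RE : R_alpha k alpha Om f = su `^ (2 + beta)^-1 * (su + sf) `^ (- (2 + beta)^-1).
  by rewrite /R_alpha BE.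
rewrite RE in deE thE.
have := balance_constant su0 sf0 h0 b0; rewrite -deE -thE.
move=> /(_ hde)[Ra0 deb hb K2b dth].
set E := h `^ (beta ^+ 2 / (2 + beta)) in deb hb K2b *.
have dthh : delta * theta <= h by rewrite dth.
have [lo up] := comparison hd hOm_open hOm_bdd hOm_sconv cf k01 a0 a1 hu hf su0
  adm h0 hde th1 dthh net sol rhoO Gx.
rewrite distrC ger0_norm ?subr_ge0//.
have de0 : 0 < delta := lt_le_trans h0 hde.
have D0 : 0 <= D by rewrite ler0n.
have M0 : 0 <= M by rewrite ler0n.
have T0 : 0 <= su + sf by rewrite addr_ge0// ltW.
have suT : su <= su + sf by rewrite lerDl.
have E0 : 0 <= E := powR_ge0 _ _.
have t1 : D * su * h `^ beta <= D * ((su + sf) * E).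
  by rewrite -mulrA ler_wpM2l// ler_pM ?powR_ge0 ?(ltW su0).
have t2 : D * (M + 1) ^+ 2 * (su + sf) * delta `^ beta
    <= D * (M + 1) ^+ 2 * ((su + sf) * E).
  rewrite -(mulrA _ (su + sf)); apply: ler_wpM2l; last exact: ler_wpM2l.
  by rewrite mulr_ge0 ?sqr_ge0.
have t3 : 32 * M ^+ 2 * (D * su * (1 + sigma)) * delta `^ (beta - 2^-1)
    * Num.sqrt (M * delta)
    <= 32 * M ^+ 2 * D * (1 + `|sigma|) * Num.sqrt M * ((su + sf) * E).
  rewrite (gtr0_norm sg0) sqrtrM// -(powR12_sqrt (ltW de0)).
  have dd : delta `^ (beta - 2^-1) * delta `^ 2^-1 = delta `^ beta.
    rewrite -powRD ?subrK//; apply/implyP => _; by rewrite gt_eqF.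
  have -> : 32 * M ^+ 2 * (D * su * (1 + sigma)) * delta `^ (beta - 2^-1)
     * (Num.sqrt M * delta `^ 2^-1)
    = 32 * M ^+ 2 * D * (1 + sigma) * Num.sqrt M
      * (su * (delta `^ (beta - 2^-1) * delta `^ 2^-1)) by ring.
  rewrite dd ler_wpM2l// ?mulr_ge0 ?sqr_ge0 ?sqrtr_ge0 ?addr_ge0 ?(ltW sg0)//.
  by rewrite ler_pM ?powR_ge0 ?(ltW su0).
have t4 : 3 * (D * su * h `^ beta) / delta ^+ 2 * rho ^+ 2
    <= 3 * D * rho ^+ 2 * ((su + sf) * E).
  have -> : 3 * (D * su * h `^ beta) / delta ^+ 2 * rho ^+ 2
    = 3 * D * rho ^+ 2 * (su * h `^ beta / delta ^+ 2) by ring.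
  apply: ler_wpM2l => //.
  by apply: mulr_ge0; [exact: mulr_ge0|exact: sqr_ge0].
rewrite -[leRHS]mulrA !mulrDl.
move: up; rewrite -/u -/su -/sf -/h -/beta -/D -/M; lra.
Qed.
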